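(* Assume that $\$(\nu)=\Omega(\nu^s)$ for some $s>0$ and that there exist a $p>1$ and a $\sigma>0$ such that $$\frac{b_{v,\boldsymbol a}}{1+\|\Psi_{v,\boldsymbol a}\|_{K\to K_v}}=\Omega\left(|v|^{\frac{\sigma(1-p)}{2}}\right)\quad\text{for all }\emptyset\neq v\in\mathcal U.$$ Assume further that $\gamma_{\{1\}}>0$ and that there exists an $\alpha>0$ with $e_N(B(K_{\{1\}}))^2=\Omega(N^{-\alpha})$. Then we have for fixed subspace sampling $$e_{N,\mathrm{fix}}(B(K))^2=\Omega\left(N^{-\frac{\alpha\sigma(p-1)}{\alpha s+\sigma(p-1)}}\right),$$ and for variable subspace sampling $$e_{N,\mathrm{var}}(B(K))^2=\Omega\left(N^{-\min\left\{\alpha,\frac{\sigma(p-1)}{s}\right\}}\right).$$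
   Context: **Function spaces.** $\mathcal U$ is the set of all finite subsets of $\mathbb N$. $D\subseteq\mathbb R$, $\rho$ is a probability measure on $D$, $\mu=\bigotimes_{n\in\mathbb N}\rho$ on $D^{\mathbb N}$. For a reproducing kernel $L$, $H(L)$ is its reproducing kernel Hilbert space, $\|\cdot\|_L$ its norm, $B(L)$ its norm unit ball. $k\neq0$ is a measurable reproducing kernel on $D\times D$ with $H(k)\cap H(1)=\{0\}$ ($H(1)$: constant functions), $M:=\int_D k(x,x)\,\rho(dx)<\infty$, $\int_D k(x,y)\,\rho(dx)=0$ for all $y\in D$, and $k(a,a)>0$ for all $a\in D$. The weights $\boldsymbol\gamma=(\gamma_u)_{u\in\mathcal U}$ are non-negative with $\gamma_\emptyset=1$ and $\sum_{u\in\mathcal U}\gamma_uM^{|u|}<\infty$. Put $k_u(\boldsymbol x,\boldsymbol y)=\prod_{j\in u}k(x_j,y_j)$ ($k_\emptyset=1$), $K_v=\sum_{u\subseteq v}\gamma_uk_u$ for $v\in\mathcal U$, $\mathfrak X=\{\boldsymbol x\in D^{\mathbb N}:\sum_{u\in\mathcal U}\gamma_uk_u(\boldsymbol x,\boldsymbol x)<\infty\}$ (one has $\mu(\mathfrak X)=1$), and $K=\sum_{u\in\mathcal U}\gamma_uk_u$ on $\mathfrak X\times\mathfrak X$. Functions $f\in H(K)$ are extended by $0$ to $D^{\mathbb N}\setminus\mathfrak X$. $I(f)=\int_{\mathfrak X}f\,d\mu$. **Projections and bias.** $\boldsymbol a\in\mathfrak X$ is a fixed anchor. For $v\in\mathcal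 U$, $(\boldsymbol x_v;\boldsymbol a)$ is the point with coordinates $x_j$ for $j\in v$ and $a_j$ for $j\notin v$; $(\Psi_{v,\boldsymbol a}f)(\boldsymbol x)=f(\boldsymbol x_v;\boldsymbol a)$; $\|\Psi_{v,\boldsymbol a}\|_{K\to K_v}$ is its operator norm as a map $H(K)\to H(K_v)$; $b_{v,\boldsymbol a}:=\sup_{f\in B(K)}|I(f)-I(\Psi_{v,\boldsymbol a}f)|$. **Algorithms, cost, error.** A randomized algorithm $Q$ uses finitely many function values of the input $f$ at points which may be chosen randomly and adaptively (depending on previously computed values), with a possibly random and adaptive number of evaluations, and outputs a real random variable $Q(f)$ computed from these values and the randomness (with the usual measurability). $\$:\mathbb N\cup\{0\}\to[0,\infty)$ is a monotone increasing function. A set of admissible anchors in $\mathfrak X$ is given (in general all of $\mathfrak X$). For $v\in\mathcal U$ and admissible $\boldsymbol a$ let $\mathfrak X_{v,\boldsymbol a}=\{\boldsymbol x\in D^{\mathbb N}: x_j=a_j\ \forall j\notin v\}$. Fixed subspace sampling: cost functions $c_{v,\boldsymbol a}(\boldsymbol x)=\$(|v|)$ if $\boldsymbol x\in\mathfrak X_{v,\boldsymbol a}$ and $\infty$ otherwise; $C_{\mathrm{fix}}$ is the set of all these. Variable subspace sampling: for strictly increasing sequences $\mathbf v=(v_i)_{i\in\mathbb N}$ of non-empty sets in $\mathcal U$ and admissible $\boldsymbol a$, $c_{\mathbf v,\boldsymbol a}(\boldsymbol x)=\inf\{\$(|v_i|):\boldsymbol x\in\mathfrak X_{v_i,\boldsymbol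 a}\}$ ($\inf\emptyset=\infty$); $C_{\mathrm{var}}$ is the set of all these. $\mathrm{cost}_c(Q,f)$ is the sum of $c(\boldsymbol x)$ over all evaluation points used by $Q$ on $f$. For $\ast\in\{\mathrm{fix},\mathrm{var}\}$: $\mathrm{cost}_\ast(Q,F)=\inf_{c\in C_\ast}\sup_{f\in F}\mathbb E(\mathrm{cost}_c(Q,f))$. Error: $e(Q,F)=\big(\sup_{f\in F}\mathbb E((I(f)-Q(f))^2)\big)^{1/2}$. $N$th minimal errors: $e_{N,\ast}(F)=\inf\{e(Q,F):\mathrm{cost}_\ast(Q,F)\le N\}$. For the univariate problem, $e_N(B(K_{\{1\}}))$ is the infimum of $e(Q,B(K_{\{1\}}))$ over all randomized algorithms using, for each $f\in B(K_{\{1\}})$, an expected number of at most $N$ function evaluations. $f=\Omega(g)$ means $g=O(f)$.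
   Formalization: The lower bound on b_{v,a}/(1+‖Ψ_{v,a}‖) is assumed with one constant for all admissible anchors a, not only for one fixed anchor; with a single fixed anchor and all of 𝔛 admissible the claim fails. The Ω relations hold with one constant for all indices ≥ 1. *)

(* Defs.v *)
From HB Require Import structures.
From mathcomp Require Import all_boot all_order all_algebra finmap.
From mathcomp Require Import all_classical all_reals all_analysis.

Set Implicit Arguments.
Unset Strict Implicit.
Unset Printing Implicit Defensive.

Import Order.TTheory GRing.Theory Num.Theory.
Import numFieldNormedType.Exports.

Local Open Scope classical_set_scope.
Local Open Scope ring_scope.

(* A set D of reals as a type. Measurable types of the library are pointed, so
   a point d0 of D (which exists as soon as D carries a probability measure) is
   recorded; nothing depends on the choice of d0. *)
Definition pointed_subset (R : realType) (D : set R) (d0 : D) : Type :=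
  set_type D.

HB.instance Definition _ (R : realType) (D : set R) (d0 : D) :=
  Choice.copy (pointed_subset d0) (set_type D).
HB.instance Definition _ (R : realType) (D : set R) (d0 : D) :=
  isPointed.Build (pointed_subset d0) d0.

(* D with the trace of the Borel sigma-algebra; D itself need not be Borel. *)
Notation borel_subset d0 :=
  (g_sigma_algebra_preimageType
    (fun x : pointed_subset d0 => (set_val x : measurableTypeR _))).

Section Sequences.
Context {d : measure_display}.

Definition coordinate_sets (T : measurableType d) : set (set (nat -> T)) :=
  [set B | exists j (A : set T), measurable A /\ B = [set x | A (x j)]].

(* T^N with the product sigma-algebra. Coordinates are numbered from 0, so that
   the first coordinate, {1} for N = {1, 2, ...}, is [fset 0] here. *)
Definition sequences (T : measurableType d) :=
  g_sigma_algebraType (@coordinate_sets T).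

(* mu is the product of countably many copies of rho. *)
Definition is_product_measure (R : realType) (T : measurableType d)
    (rho : probability T R) (mu : probability (sequences T) R) : Prop :=
  forall (J : {fset nat}) (A : nat -> set T), (forall j, measurable (A j)) ->
  mu [set x : sequences T | forall j, j \in J -> A j (x j)] =
  (\prod_(j <- J) fine (rho (A j)))%:E.

End Sequences.

Section ReproducingKernels.
Context {R : realType}.

Definition reproducing_kernel (E : Type) (L : E -> E -> R) : Prop :=
  (forall x y, L x y = L y x) /\
  (forall n (c : 'I_n -> R) (x : 'I_n -> E),
     0 <= \sum_(i < n) \sum_(j < n) c i * c j * L (x i) (x j)).

(* The reproducing kernel Hilbert space of a kernel L on X x X, characterized,
   as usual, by its defining properties. By the Moore-Aronszajn theorem there is
   exactly one such space (dotp being relevant on the carrier only). A function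
   on X is represented by its extension by 0 to the ambient type E. *)
Record rkhs (E : Type) (X : set E) (L : E -> E -> R) := RKHS {
  rkhs_fun : set (E -> R) ;
  dotp : (E -> R) -> (E -> R) -> R ;
  rkhs_out : forall f x, rkhs_fun f -> ~ X x -> f x = 0 ;
  rkhs0 : rkhs_fun (fun=> 0) ;
  rkhsP : forall (a : R) f g, rkhs_fun f -> rkhs_fun g ->
    rkhs_fun (fun x => a * f x + g x) ;
  dotpC : forall f g, rkhs_fun f -> rkhs_fun g -> dotp f g = dotp g f ;
  dotpP : forall (a : R) f g h, rkhs_fun f -> rkhs_fun g -> rkhs_fun h ->
    dotp (fun x => a * f x + g x) h = a * dotp f h + dotp g h ;
  dotp_ge0 : forall f, rkhs_fun f -> 0 <= dotp f f ;
  dotp_eq0 : forall f, rkhs_fun f -> dotp f f = 0 -> f = (fun=> 0) ;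
  rkhs_complete : forall u : nat -> (E -> R), (forall n, rkhs_fun (u n)) ->
    (forall e : R, 0 < e -> exists N, forall m n, (N <= m)%N -> (N <= n)%N ->
       Num.sqrt (dotp (u m \- u n) (u m \- u n)) < e) ->
    exists2 f, rkhs_fun f &
      (fun n => Num.sqrt (dotp (u n \- f) (u n \- f))) @ \oo --> (0 : R) ;
  rkhs_section : forall y, X y -> rkhs_fun (patch (fun=> 0) X (fun x => L x y)) ;
  rkhs_reproducing : forall f y, rkhs_fun f -> X y ->
    dotp f (patch (fun=> 0) X (fun x => L x y)) = f y
}.

(* The norm takes the value +oo outside of H. *)
Definition rkhs_norm (E : Type) (X : set E) (L : E -> E -> R) (H : rkhs X L)
    (f : E -> R) : \bar R :=
  if `[< rkhs_fun H f >] then (Num.sqrt (dotp H f f))%:E else +oo%E.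

Definition unit_ball (E : Type) (X : set E) (L : E -> E -> R) (H : rkhs X L) :
    set (E -> R) :=
  [set f | rkhs_fun H f /\ (rkhs_norm H f <= 1)%E].

(* Operator norm of Phi as a map from H to H'; it is +oo when Phi does not map
   H into H'. *)
Definition operator_norm (E E' : Type) (X : set E) (X' : set E')
    (L : E -> E -> R) (L' : E' -> E' -> R) (H : rkhs X L) (H' : rkhs X' L')
    (Phi : (E -> R) -> (E' -> R)) : \bar R :=
  ereal_sup [set rkhs_norm H' (Phi f) | f in unit_ball H].

End ReproducingKernels.

(* Unconditional sum of a summable family of real numbers. *)
Definition real_sum (R : realType) (I : choiceType) (F : I -> R) : R :=
  fine (\esum_(i in [set: I]) (Num.max (F i) 0)%:E) -
  fine (\esum_(i in [set: I]) (Num.max (- F i) 0)%:E).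

Section FunctionSpaces.
Context {R : realType} {d : measure_display}.
Variable T : measurableType d.
Implicit Types (k : T -> T -> R) (gamma : {fset nat} -> R) (u v : {fset nat}).

Definition kernel_prod k u (x y : sequences T) : R :=
  \prod_(j <- u) k (x j) (y j).

Definition kernel_fin k gamma v (x y : sequences T) : R :=
  \sum_(u <- fpowerset v) gamma u * kernel_prod k u x y.

Definition frakX k gamma : set (sequences T) :=
  [set x | (\esum_(u in [set: {fset nat}])
              (gamma u * kernel_prod k u x x)%:E < +oo)%E].

(* Only meaningful on frakX x frakX, where the family is summable. *)
Definition kernel_inf k gamma (x y : sequences T) : R :=
  real_sum (fun u => gamma u * kernel_prod k u x y).

Definition diag_moment (rho : probability T R) k : \bar R :=
  (\int[rho]_x (k x x)%:E)%E.

Definition integral_on (X : set (sequences T))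
    (mu : probability (sequences T) R) (f : sequences T -> R) : R :=
  \int[mu]_(x in X) f x.

Definition glue v (x a : sequences T) : sequences T :=
  fun j => if j \in v then x j else a j.

Definition Psi v (a : sequences T) (f : sequences T -> R) :
    sequences T -> R :=
  fun x => f (glue v x a).

Definition bias (I : (sequences T -> R) -> R) (F : set (sequences T -> R))
    v (a : sequences T) : \bar R :=
  ereal_sup [set `|I f - I (Psi v a f)|%:E | f in F].

End FunctionSpaces.

Section Algorithms.
Context {R : realType} {d : measure_display}.

(* For each random outcome w, next_point w is applied to the list of function
   values computed so far; it returns the next evaluation point, or None in
   order to stop, in which case output w yields the result. *)
Record rand_alg (E : measurableType d) := RandAlg {
  alg_disp : measure_display ;
  alg_space : measurableType alg_disp ;
  alg_prob : probability alg_space R ;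
  next_point : alg_space -> seq R -> option E ;
  output : alg_space -> seq R -> R
}.

Variable E : measurableType d.
Implicit Types (Q : rand_alg E) (f : E -> R) (F : set (E -> R)).

(* The function values computed during the first n steps. *)
Fixpoint history Q f (w : alg_space Q) (n : nat) : seq R :=
  if n is m.+1 then
    let h := history f w m in
    if next_point w h is Some x then rcons h (f x) else h
  else [::].

(* The n-th evaluation point (counted from 0), None after termination. *)
Definition point Q f (w : alg_space Q) (n : nat) : option E :=
  next_point w (history f w n).

(* The history is constant after termination, so the choice of a step at which
   the algorithm has terminated is immaterial. *)
Definition result Q f (w : alg_space Q) : R :=
  output w (history f w (xget 0%N [set n | point f w n = None])).

(* Q is a randomized algorithm for the inputs in F: it terminates, and its
   result and its evaluation points (hence also their number and their costs)
   are measurable. *)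
Definition algorithm_for F Q : Prop :=
  forall f, F f ->
  [/\ forall w : alg_space Q, exists n, point f w n = None,
      measurable_fun [set: alg_space Q] (result f) &
      forall n (B : set E), measurable B ->
        measurable [set w : alg_space Q |
                     exists2 x, point f w n = Some x & B x]].

Definition eval_cost (c : E -> \bar R) Q f (w : alg_space Q) : \bar R :=
  (\sum_(n <oo) if point f w n is Some x then c x else 0)%E.

Definition expected_cost (c : E -> \bar R) Q f : \bar R :=
  (\int[alg_prob Q]_w eval_cost c f w)%E.

Definition expected_evals Q f : \bar R := expected_cost (fun=> 1%E) Q f.

Definition cost (C : set (E -> \bar R)) Q F : \bar R :=
  ereal_inf [set ereal_sup [set expected_cost c Q f | f in F] | c in C].

(* I is the functional to be approximated. *)
Definition error (I : (E -> R) -> R) Q F : \bar R :=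
  ((ereal_sup [set \int[alg_prob Q]_w ((I f - result f w) ^+ 2)%:E | f in F])
     `^ (2^-1))%E.

Definition min_error (I : (E -> R) -> R) (C : set (E -> \bar R)) F (N : nat) :
    \bar R :=
  ereal_inf [set e | exists Q,
    [/\ algorithm_for F Q, (cost C Q F <= N%:R%:E)%E & e = error I Q F]].

Definition min_error_evals (I : (E -> R) -> R) F (N : nat) : \bar R :=
  ereal_inf [set e | exists Q,
    [/\ algorithm_for F Q,
        forall f, F f -> (expected_evals Q f <= N%:R%:E)%E &
        e = error I Q F]].

End Algorithms.

Section CostModels.
Context {R : realType} {d : measure_display}.
Variable T : measurableType d.
Implicit Types (doll : nat -> R) (adm : set (sequences T)).

(* doll n is the cost of an evaluation with n active variables, usually written
   with a dollar sign. *)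
Definition anchored_set (v : {fset nat}) (a : sequences T) :
    set (sequences T) :=
  [set x | forall j, j \notin v -> x j = a j].

Definition cost_fix doll (v : {fset nat}) (a x : sequences T) : \bar R :=
  if `[< anchored_set v a x >] then (doll #|` v|)%:E else +oo%E.

Definition cost_var doll (vs : nat -> {fset nat}) (a x : sequences T) :
    \bar R :=
  ereal_inf [set (doll #|` vs i|)%:E | i in [set i | anchored_set (vs i) a x]].

Definition C_fix doll adm : set (sequences T -> \bar R) :=
  [set c | exists v, exists2 a, adm a & c = cost_fix doll v a].

Definition C_var doll adm : set (sequences T -> \bar R) :=
  [set c | exists vs : nat -> {fset nat},
    [/\ forall i, vs i != fset0,
        forall i, (vs i `<` vs i.+1)%fset &
        exists2 a, adm a & c = cost_var doll vs a]].

End CostModels.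

(* f = Omega(g) on the index set S, i.e. g = O(f) with one constant for all
   indices in S. *)
Definition is_Omega (R : realType) (I : Type) (S : set I) (f : I -> \bar R)
    (g : I -> R) : Prop :=
  exists2 c : R, 0 < c & forall i, S i -> ((c * g i)%:E <= f i)%E.

(* Main.v *)
(** Idea.  Let [X] be the set [frakX] of the definitions, [m = |v|] and
    [beta = sigma (p - 1)].

    Bias: an algorithm that samples only in [anchored_set v a] cannot tell
    [g = (f - Psi f) / (1 + |Psi|)] from [- g], because both vanish there, and
    both belong to the unit ball of [H(K)]. Hence its squared error is at least
    [I(g)^2 / 2], and optimizing over [f] gives a bound of order [m^-beta]. By
    Markov's inequality it suffices to leave [anchored_set v a] with probability
    at most 1/2, which holds when evaluations outside cost at least [4 N] and the
    expected cost is at most [2 N].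

    Univariate problem: the restriction to [X] maps the unit ball of
    [H(K_{1})] into that of [H(K)], so an algorithm for [H(K)] in which every
    evaluation costs at least [t] solves the univariate problem with [2 N / t]
    expected evaluations.

    In the fixed subspace model [t = doll m], and the bound follows by comparing
    [m] with [N^(alpha / (alpha s + beta))]. In the variable model one takes
    [t = doll 1] for the univariate bound, and for the bias bound the largest
    [v_i] with [doll |v_i| < 4 N]. *)

Require Import Defs.
From HB Require Import structures.
From mathcomp Require Import all_boot all_order all_algebra finmap.
From mathcomp Require Import all_classical all_reals all_analysis.
From mathcomp Require Import measurable_realfun ring lra.

Set Implicit Arguments.
Unset Strict Implicit.
Unset Printing Implicit Defensive.

Import Order.TTheory GRing.Theory Num.Theory.
Import numFieldNormedType.Exports HBNNSimple.

Local Open Scope classical_set_scope.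
Local Open Scope ring_scope.

(** * Positive kernels *)

Section QuadraticForms.
Context {R : realType}.

(* Finite linear combinations [\sum_p p.1 * delta_(h p.2)] are lists of pairs
   of a coefficient and an index of a point. *)
Definition gram (E I : Type) (L : E -> E -> R) (h : I -> E)
    (s : seq (R * I)) : R :=
  \sum_(p <- s) \sum_(q <- s) p.1 * q.1 * L (h p.2) (h q.2).

Definition positive_kernel (E : Type) (L : E -> E -> R) : Prop :=
  (forall x y, L x y = L y x) /\ (forall s, 0 <= gram L id s).

Lemma gram_map (E I : Type) (L : E -> E -> R) (h : I -> E) s :
  gram L h s = gram L id [seq (p.1, h p.2) | p <- s].
Proof.
by rewrite /gram big_map; apply: eq_bigr => p _; rewrite big_map.
Qed.

Lemma reproducing_kernel_positive (E : Type) (L : E -> E -> R) :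
  reproducing_kernel L -> positive_kernel L.
Proof.
move=> [Lsym Lpos]; split => // s.
have := Lpos (size s) (fun i => (tnth (in_tuple s) i).1)
  (fun i => (tnth (in_tuple s) i).2).
congr (0 <= _); rewrite /gram (big_tnth _ _ s); apply: eq_bigr => i _.
by rewrite (big_tnth _ _ s).
Qed.

Lemma quadratic_ge0_discr (a b c : R) :
  (forall t, 0 <= a + 2 * t * b + t ^+ 2 * c) -> 0 <= c -> b ^+ 2 <= a * c.
Proof.
move=> h; rewrite le_eqVlt => /orP[/eqP c0|c0].
  subst c; rewrite mulr0; have [->|b0] := eqVneq b 0; first by rewrite expr0n.
  (* With [c = 0] the form is affine in [t]; this [t] makes it equal to -1. *)
  have := h (- (a + 1) / (2 * b)).
  have -> : a + 2 * (- (a + 1) / (2 * b)) * b + (- (a + 1) / (2 * b)) ^+ 2 * 0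
    = -1 by field.
  by rewrite oppr_ge0 ler10.
(* The minimizer of the quadratic in [t]. *)
have := h (- b / c).
have -> : a + 2 * (- b / c) * b + (- b / c) ^+ 2 * c = (a * c - b ^+ 2) / c.
  by field; rewrite gt_eqF.
by rewrite pmulr_lge0 ?invr_gt0// subr_ge0.
Qed.

Lemma positive_kernel_diag_ge0 (E : Type) (L : E -> E -> R) x :
  positive_kernel L -> 0 <= L x x.
Proof.
move=> [_ /(_ [:: (1, x)])]; rewrite /gram !big_cons !big_nil /=.
by rewrite !addr0 !mul1r.
Qed.

Lemma gram_cons (E : Type) (L : E -> E -> R) (c : R) x s :
  (forall x y, L x y = L y x) ->
  gram L id ((c, x) :: s) =
  c ^+ 2 * L x x + 2 * c * (\sum_(p <- s) p.1 * L p.2 x) + gram L id s.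
Proof.
move=> Lsym; rewrite /gram big_cons big_cons /=.
under [in X in _ + X = _]eq_bigr do rewrite big_cons /=.
rewrite big_split /= addrA; congr (_ + _).
have -> : \sum_(q <- s) c * q.1 * L x q.2 = c * \sum_(p <- s) p.1 * L p.2 x.
  by rewrite mulr_sumr; apply: eq_bigr => q _; rewrite Lsym mulrA.
have -> : \sum_(i <- s) i.1 * c * L i.2 x = c * \sum_(p <- s) p.1 * L p.2 x.
  by rewrite mulr_sumr; apply: eq_bigr => q _; rewrite mulrA (mulrC c).
by ring.
Qed.

(** Adding [t] times the point mass at [x] to [s] gives a nonnegative quadratic in [t]; its
    discriminant is the claim. *)
Lemma positive_kernel_cs (E : Type) (L : E -> E -> R) x s :
  positive_kernel L ->
  (\sum_(p <- s) p.1 * L p.2 x) ^+ 2 <= gram L id s * L x x.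
Proof.
move=> Lpos; apply: quadratic_ge0_discr => [t|]; last first.
  exact: positive_kernel_diag_ge0.
have := Lpos.2 ((t, x) :: s); rewrite gram_cons; last by case: Lpos.
by congr (0 <= _); ring.
Qed.

Lemma positive_kernel_cs2 (E : Type) (L : E -> E -> R) x y :
  positive_kernel L -> L x y ^+ 2 <= L x x * L y y.
Proof.
move=> Lpos; have := positive_kernel_cs y [:: (1, x)] Lpos.
by rewrite /gram !big_cons !big_nil /= !addr0 !mul1r.
Qed.

Lemma positive_kernel_eq0 (E : Type) (L : E -> E -> R) x y :
  positive_kernel L -> L x x = 0 -> L x y = 0.
Proof.
move=> Lpos Lx; have := positive_kernel_cs2 x y Lpos.
rewrite Lx mul0r => h; apply/eqP; rewrite -sqrf_eq0.
by rewrite eq_le h sqr_ge0.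
Qed.

(** For positive [L] with [L z z > 0], this is the kernel of the functions in the space of [L] that
    vanish at [z]. *)
Definition schur_complement (E : Type) (L : E -> E -> R) (z x y : E) : R :=
  L x y - L x z * L z y / L z z.

(** [A] is its Schur complement plus a rank one kernel, and multiplying [B] by a rank one kernel
    only rescales the coefficients of the combination. *)
Lemma gram_schur_complement (E I : Type) (A B : E -> E -> R) z (h : I -> E) s :
  (forall x y, A x y = A y x) ->
  gram (fun x y => A x y * B x y) h s =
  gram (fun x y => schur_complement A z x y * B x y) h s +
  (A z z)^-1 * gram B id [seq (p.1 * A (h p.2) z, h p.2) | p <- s].
Proof.
move=> Asym; rewrite /gram big_map mulr_sumr -big_split /=; apply: eq_bigr => p _.
rewrite big_map mulr_sumr -big_split /=; apply: eq_bigr => q _.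
by rewrite /schur_complement (Asym z); ring.
Qed.

(** Removing the rank one part lowers the Gram form by [b^2 / L z z], which by Cauchy-Schwarz is at
    most the form itself. *)
Lemma schur_complement_positive (E : Type) (L : E -> E -> R) z :
  positive_kernel L -> 0 < L z z -> positive_kernel (schur_complement L z).
Proof.
move=> Lpos z0; have [Lsym Lge0] := Lpos; split=> [x y|s].
  by rewrite /schur_complement (Lsym x z) (Lsym z y) (Lsym x y); ring.
set b := \sum_(p <- s) p.1 * L p.2 z.
have -> : gram (schur_complement L z) id s = gram L id s - b ^+ 2 / L z z.
  have -> : b ^+ 2 / L z z = \sum_(p <- s) \sum_(q <- s)
      (p.1 * L p.2 z) * (q.1 * L q.2 z) / L z z.
    rewrite expr2 /b [in LHS]mulr_suml mulr_suml; apply: eq_bigr => p _.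
    by rewrite mulr_sumr mulr_suml.
  rewrite /gram -sumrB; apply: eq_bigr => p _.
  rewrite -sumrB; apply: eq_bigr => q _; rewrite /schur_complement (Lsym z).
  by ring.
rewrite subr_ge0 ler_pdivrMr//; exact: positive_kernel_cs.
Qed.

(* Induction on the number of points at which [A] does not vanish on the
   diagonal: subtracting the rank one part of [A] at one of them leaves the
   Schur complement, which vanishes at that point too. *)
Lemma positive_kernelM (E : choiceType) (A B : E -> E -> R) :
  positive_kernel A -> positive_kernel B ->
  positive_kernel (fun x y => A x y * B x y).
Proof.
move=> Apos Bpos; split=> [x y|s]; first by rewrite Apos.1 Bpos.1.
have [n] := ubnP (count (fun p => A p.2 p.2 != 0) s).
elim: n A Apos => // n IH A Apos; rewrite ltnS => sn.
have [/hasP|/hasPn s0] := boolP (has (fun p => A p.2 p.2 != 0) s); last first.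
  rewrite /gram big_seq big1// => p ps; rewrite big1// => q _.
  rewrite (positive_kernel_eq0 _ Apos) ?mul0r ?mulr0//.
  by apply/eqP; have := s0 _ ps; rewrite negbK.
move=> [p ps z0]; set z := p.2 in z0.
have zgt0 : 0 < A z z by rewrite lt_neqAle eq_sym z0 positive_kernel_diag_ge0.
rewrite (gram_schur_complement _ z); last exact: Apos.1.
apply: addr_ge0; last first.
  by rewrite mulr_ge0 ?invr_ge0 ?(ltW zgt0)//; exact: Bpos.2.
apply: IH; first exact: schur_complement_positive.
apply: leq_trans sn.
have sub x : schur_complement A z x x != 0 -> A x x != 0.
  apply: contraNN => /eqP Ax; rewrite /schur_complement Ax.
  by rewrite (positive_kernel_eq0 z Apos Ax) mul0r mul0r subrr.
have /path.splitPr [s1 s2] := ps.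
rewrite !count_cat /= z0 /schur_complement mulfK ?subrr ?eqxx; last first.
  by rewrite gt_eqF.
rewrite add0n add1n addnS ltnS leq_add//; apply: sub_count => q /=; exact: sub.
Qed.

End QuadraticForms.

(** * Reproducing kernel Hilbert spaces *)

Section RKHSTheory.
Context {R : realType} (E : Type) (X : set E) (L : E -> E -> R).
Variable H : rkhs X L.
Implicit Types (f g : E -> R) (s t : seq (R * X)).

Let ker y : E -> R := patch (fun=> 0) X (fun x => L x y).

Definition kernel_comb s : E -> R :=
  fun y => \sum_(p <- s) p.1 * ker (set_val p.2) y.

Definition eval_comb f s : R := \sum_(p <- s) p.1 * f (set_val p.2).

(** The list version of [a * f + g], the shape in which [rkhsP] and [dotpP] express linearity. *)
Definition axpy_comb (a : R) s t : seq (R * X) :=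
  [seq (a * p.1, p.2) | p <- s] ++ t.

Lemma kernel_comb_axpy a s t :
  kernel_comb (axpy_comb a s t) = fun y => a * kernel_comb s y + kernel_comb t y.
Proof.
apply: funext => y; rewrite /kernel_comb big_cat big_map mulr_sumr; congr (_ + _).
by apply: eq_bigr => p _; rewrite mulrA.
Qed.

Lemma eval_comb_nil f : eval_comb f [::] = 0.
Proof. by rewrite /eval_comb big_nil. Qed.

Lemma eval_comb_axpy f a s t :
  eval_comb f (axpy_comb a s t) = a * eval_comb f s + eval_comb f t.
Proof.
rewrite /eval_comb big_cat big_map mulr_sumr; congr (_ + _).
by apply: eq_bigr => p _; rewrite mulrA.
Qed.

Lemma kernel_combP s : rkhs_fun H (kernel_comb s).
Proof.
elim: s => [|p s IH].
  have -> : kernel_comb [::] = fun=> 0.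
    by apply: funext => y; rewrite /kernel_comb big_nil.
  exact: rkhs0.
have -> : kernel_comb (p :: s) = fun y => p.1 * ker (set_val p.2) y + kernel_comb s y.
  by apply: funext => y; rewrite /kernel_comb big_cons.
by apply: rkhsP => //; apply: rkhs_section; exact: set_valP.
Qed.

Lemma dotp_kernel_comb f s : rkhs_fun H f ->
  dotp H (kernel_comb s) f = eval_comb f s.
Proof.
move=> Hf; elim: s => [|p s IH].
  (* The zero function is written in the shape to which [dotpP] applies. *)
  have -> : kernel_comb [::] = fun y => -1 * f y + f y.
    by apply: funext => y; rewrite /kernel_comb big_nil mulN1r addNr.
  by rewrite dotpP// mulN1r addNr /eval_comb big_nil.
have -> : kernel_comb (p :: s) = fun y => p.1 * ker (set_val p.2) y + kernel_comb s y.
  by apply: funext => y; rewrite /kernel_comb big_cons.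
have Hp : rkhs_fun H (ker (set_val p.2)) by apply: rkhs_section; exact: set_valP.
rewrite dotpP// ?IH; last exact: kernel_combP.
rewrite /eval_comb big_cons dotpC// rkhs_reproducing//; exact: set_valP.
Qed.

Lemma dotp_kernel_comb_gram s :
  dotp H (kernel_comb s) (kernel_comb s) = gram L set_val s.
Proof.
rewrite dotp_kernel_comb; last exact: kernel_combP.
rewrite /eval_comb /gram; apply: eq_bigr => p _.
rewrite /kernel_comb mulr_sumr; apply: eq_bigr => q _.
by rewrite /ker patchE mem_set ?mulrA//; exact: set_valP.
Qed.

Lemma dotp_axpy (a : R) f g : rkhs_fun H f -> rkhs_fun H g ->
  dotp H (fun x => a * f x + g x) (fun x => a * f x + g x) =
  a ^+ 2 * dotp H f f + 2 * a * dotp H f g + dotp H g g.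
Proof.
move=> Hf Hg; have Hfg := rkhsP a Hf Hg.
rewrite dotpP// (dotpC Hf Hfg) (dotpC Hg Hfg) !dotpP// (dotpC Hg Hf).
by ring.
Qed.

Lemma rkhs_fun_sub f g : rkhs_fun H f -> rkhs_fun H g -> rkhs_fun H (f \- g).
Proof.
move=> Hf Hg; have -> : f \- g = fun x => -1 * g x + f x.
  by apply: funext => x /=; rewrite mulN1r addrC.
exact: rkhsP.
Qed.

Lemma dotp_sub f g : rkhs_fun H f -> rkhs_fun H g ->
  dotp H (f \- g) (f \- g) = dotp H f f - 2 * dotp H f g + dotp H g g.
Proof.
move=> Hf Hg; have -> : f \- g = fun x => -1 * g x + f x.
  by apply: funext => x /=; rewrite mulN1r addrC.
by rewrite dotp_axpy// (dotpC Hg Hf); ring.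
Qed.

Lemma dotp_subl f g h : rkhs_fun H f -> rkhs_fun H g -> rkhs_fun H h ->
  dotp H (f \- g) h = dotp H f h - dotp H g h.
Proof.
move=> Hf Hg Hh; have -> : f \- g = fun x => -1 * g x + f x.
  by apply: funext => x /=; rewrite mulN1r addrC.
by rewrite dotpP// mulN1r addrC.
Qed.

Lemma dotp0l f : rkhs_fun H f -> dotp H (fun=> 0) f = 0.
Proof.
move=> Hf; have -> : (fun=> 0) = f \- f by apply: funext => y /=; rewrite subrr.
by rewrite dotp_subl// subrr.
Qed.

Lemma dotp_cs f g : rkhs_fun H f -> rkhs_fun H g ->
  dotp H f g ^+ 2 <= dotp H f f * dotp H g g.
Proof.
move=> Hf Hg; rewrite mulrC; apply: quadratic_ge0_discr => [t|].
  have := dotp_ge0 (rkhsP t Hf Hg); rewrite dotp_axpy//.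
  by congr (0 <= _); ring.
exact: dotp_ge0.
Qed.

Lemma dotp_cs_sqrt f g : rkhs_fun H f -> rkhs_fun H g ->
  `|dotp H f g| <= Num.sqrt (dotp H f f) * Num.sqrt (dotp H g g).
Proof.
move=> Hf Hg; rewrite -sqrtrM ?dotp_ge0// -sqrtr_sqr ler_sqrt ?dotp_cs//.
by rewrite mulr_ge0 ?dotp_ge0.
Qed.

Lemma rkhs_eval_le f y : rkhs_fun H f -> X y ->
  `|f y| <= Num.sqrt (dotp H f f) * Num.sqrt (L y y).
Proof.
move=> Hf Xy; have Hy : rkhs_fun H (ker y) by exact: rkhs_section.
rewrite -(rkhs_reproducing Hf Xy) (le_trans (dotp_cs_sqrt Hf Hy))//.
by rewrite rkhs_reproducing// /ker patchE mem_set.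
Qed.

Lemma eval_comb_le f s : rkhs_fun H f ->
  eval_comb f s ^+ 2 <= dotp H f f * gram L set_val s.
Proof.
move=> Hf; rewrite -dotp_kernel_comb// -dotp_kernel_comb_gram mulrC.
by apply: dotp_cs => //; exact: kernel_combP.
Qed.

(** * Functions whose evaluation functional is bounded in the Gram seminorm *)

Section Representation.
Variables (f : E -> R) (C : R).
Hypothesis C_ge0 : 0 <= C.
Hypothesis f_out : forall x, ~ X x -> f x = 0.
Hypothesis f_le : forall s, eval_comb f s ^+ 2 <= C ^+ 2 * gram L set_val s.

(* [f] is the point of [H] minimizing the quadratic functional
   [|g|^2 - 2 <f, g>], which makes sense on the span of the kernel sections
   before [f] is known to belong to [H]. *)
Let energy s : R := gram L set_val s - 2 * eval_comb f s.

Let gram_ge0 s : 0 <= gram L set_val s.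
Proof. by rewrite -dotp_kernel_comb_gram dotp_ge0//; exact: kernel_combP. Qed.

(** Completing the square: with [n] the square root of the Gram form, the energy is at least
    [n^2 - 2 C n]. *)
Let energy_ge s : - C ^+ 2 <= energy s.
Proof.
have g0 := gram_ge0 s; have := f_le s; rewrite /energy.
set l := eval_comb f s; set G := gram L set_val s in g0 *.
rewrite -(sqr_sqrtr g0) -exprMn => h.
have : l <= C * Num.sqrt G.
  rewrite (le_trans (ler_norm _))// -sqrtr_sqr -[leRHS]ger0_norm; last first.
    by rewrite mulr_ge0 ?sqrtr_ge0.
  by rewrite -sqrtr_sqr ler_sqrt// sqr_ge0.
by move=> h'; have := sqr_ge0 (Num.sqrt G - C); nra.
Qed.

Let energy_inf : R := inf (range energy).

Let energy_has_inf : has_inf (range energy).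
Proof.
split; first by exists (energy [::]); exists [::].
by exists (- C ^+ 2) => _ [s _ <-].
Qed.

Let energy_inf_le s : energy_inf <= energy s.
Proof. by apply: ge_inf; [case: energy_has_inf | exists s]. Qed.

Let energy_axpy a s t : energy (axpy_comb a s t) =
  a ^+ 2 * gram L set_val s + 2 * a * dotp H (kernel_comb s) (kernel_comb t)
  + gram L set_val t - 2 * (a * eval_comb f s + eval_comb f t).
Proof.
rewrite /energy eval_comb_axpy -dotp_kernel_comb_gram kernel_comb_axpy dotp_axpy.
- by rewrite !dotp_kernel_comb_gram.
- exact: kernel_combP.
- exact: kernel_combP.
Qed.

Let kernel_comb_sub_le s t :
  dotp H (kernel_comb s \- kernel_comb t) (kernel_comb s \- kernel_comb t) <=
  2 * (energy s - energy_inf) + 2 * (energy t - energy_inf).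
Proof.
(* The midpoint of [s] and [t] has energy at least the infimum; the parallelogram identity turns
   this into the bound. *)
have := energy_inf_le (axpy_comb 2^-1 s (axpy_comb 2^-1 t [::])).
have dn : kernel_comb (axpy_comb 2^-1 t [::]) =
    fun y => 2^-1 * kernel_comb t y + 0.
  by rewrite kernel_comb_axpy; apply: funext => y; rewrite {2}/kernel_comb big_nil.
rewrite energy_axpy -[gram _ _ (axpy_comb _ t _)]dotp_kernel_comb_gram dn.
have Hs := kernel_combP s; have Ht := kernel_combP t; have H0 := rkhs0 H.
rewrite dotp_axpy// (dotpC Hs (rkhsP _ Ht H0)) dotpP//.
rewrite (dotpC Ht H0) !dotp0l// eval_comb_axpy eval_comb_nil dotp_sub//.
rewrite /energy -!dotp_kernel_comb_gram.
by rewrite (dotpC Ht Hs); lra.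
Qed.

(** A minimizing sequence of the energy is Cauchy, and the Euler equation identifies its limit with
    [f]. The sequence is kept in the conclusion because it approximates [f] by kernel sections. *)
Lemma rkhs_representation :
  [/\ rkhs_fun H f, dotp H f f <= C ^+ 2 &
   exists u : nat -> seq (R * X),
     forall y, (fun n => kernel_comb (u n) y) @ \oo --> f y].
Proof.
have /choice [u uP] : forall n : nat, exists s,
    energy s < energy_inf + n.+1%:R^-1.
  move=> n; have [_ [s _ <-] h] := inf_adherent
    (ltac:(by rewrite invr_gt0) : 0 < (n.+1%:R^-1 : R)) energy_has_inf.
  by exists s.
have cauchy (e : R) : 0 < e -> exists N, forall m n, (N <= m)%N -> (N <= n)%N ->
    Num.sqrt (dotp H (kernel_comb (u m) \- kernel_comb (u n))
                     (kernel_comb (u m) \- kernel_comb (u n))) < e.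
  (* Both energy gaps are below [e^2 / 4], and each enters with a factor 2. *)
  move=> e0; have e4 : 0 < e ^+ 2 / 4 by rewrite divr_gt0 ?exprn_gt0.
  have [N _ NP] := near_infty_natSinv_lt (PosNum e4).
  exists N => m n Nm Nn; rewrite -[ltRHS]gtr0_norm// -sqrtr_sqr ltr_sqrt ?exprn_gt0//.
  apply: (le_lt_trans (kernel_comb_sub_le _ _)).
  have := NP _ Nm; have := NP _ Nn; have := uP m; have := uP n => /=.
  by move: (n.+1%:R^-1) (m.+1%:R^-1) => x y; lra.
have [g Hg ug] := rkhs_complete (fun n => kernel_combP (u n)) cauchy.
set d := (fun n => Num.sqrt _) in ug.
have Hu n := kernel_combP (u n).
have dotp_cvg h : rkhs_fun H h ->
    (fun n => dotp H (kernel_comb (u n)) h) @ \oo --> dotp H g h.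
  move=> Hh; apply/cvgrPdist_le => e e0.
  have : (fun n => d n * Num.sqrt (dotp H h h)) @ \oo --> (0 * Num.sqrt (dotp H h h)).
    by apply: cvgM => //; exact: cvg_cst.
  rewrite mul0r => /cvgrPdist_le /(_ _ e0); apply: filterS => n.
  rewrite sub0r normrN [X in X <= _ -> _]ger0_norm ?mulr_ge0 ?sqrtr_ge0//.
  apply: le_trans; rewrite distrC -dotp_subl//.
  by apply: dotp_cs_sqrt => //; exact: rkhs_fun_sub.
have cvg_y y : (fun n => kernel_comb (u n) y) @ \oo --> g y.
  have [Xy|Xy] := pselect (X y); last first.
    rewrite (rkhs_out Hg Xy); rewrite (_ : (fun n => _) = fun=> 0); first exact: cvg_cst.
    by apply: funext => n; rewrite (rkhs_out (Hu n) Xy).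
  have Hy : rkhs_fun H (ker y) by exact: rkhs_section.
  have := dotp_cvg _ Hy; rewrite rkhs_reproducing//.
  by under eq_fun do rewrite rkhs_reproducing//.
have fg : f = g.
  apply: funext => y; have [Xy|Xy] := pselect (X y); last first.
    by rewrite f_out// (rkhs_out Hg Xy).
  pose y' : X := SigSub (mem_set Xy).
  have Lyy : 0 <= L y y.
    have := gram_ge0 [:: (1, y')]; rewrite /gram !big_cons !big_nil /=.
    by rewrite !addr0 !mul1r.
  (* Euler equation: if [2 t (g y - f y) + t^2 L y y] is nonnegative for all [t], the missing
     constant term forces the linear coefficient to vanish. *)
  suff : (g y - f y) ^+ 2 <= 0 * L y y.
    rewrite mul0r => h; apply/esym/eqP; rewrite -subr_eq0 -sqrf_eq0.
    by rewrite eq_le h sqr_ge0.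
  apply: quadratic_ge0_discr => // t; rewrite add0r.
  have Hy : rkhs_fun H (ker y) by exact: rkhs_section.
  have combE : kernel_comb [:: (1, y')] = ker y.
    by apply: funext => z; rewrite /kernel_comb big_cons big_nil addr0 mul1r.
  (* Moving [u n] by [t] times the section at [y] cannot lower its energy by more than its gap to
     the infimum, which is below [1 / (n + 1)]. *)
  have step n : 0 <= n.+1%:R^-1
      + (2 * t * (kernel_comb (u n) y - f y) + t ^+ 2 * L y y).
    have := energy_inf_le (axpy_comb t [:: (1, y')] (u n)).
    rewrite energy_axpy dotpC ?combE// rkhs_reproducing//.
    rewrite {1}/eval_comb {1}/gram !big_cons !big_nil /= !addr0 !mul1r.
    have := uP n; rewrite /energy; move: (n.+1%:R^-1) => x.
    by rewrite /y' /=; lra.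
  have lim0 : (fun n : nat => n.+1%:R^-1
      + (2 * t * (kernel_comb (u n) y - f y) + t ^+ 2 * L y y)) @ \oo -->
      (0 + (2 * t * (g y - f y) + t ^+ 2 * L y y)).
    apply: cvgD; first exact: cvg_harmonic.
    apply: cvgD; last exact: cvg_cst.
    by apply: cvgM; [exact: cvg_cst|apply: cvgB => //; exact: cvg_cst].
  move: lim0; rewrite add0r => lim0.
  rewrite -(cvg_lim (@Rhausdorff R) lim0).
  apply: limr_ge; first by apply/cvg_ex; eexists; exact: lim0.
  by apply: nearW => n; exact: step.
subst g; split => //; last by exists u.
(* The null case is separate because the bound is obtained below by dividing by [dotp H f f]. *)
have [f0|f0] := eqVneq (dotp H f f) 0; first by rewrite f0 sqr_ge0.
have fgt0 : 0 < dotp H f f by rewrite lt_neqAle eq_sym f0 dotp_ge0.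
have := dotp_cvg _ Hg => cvg1.
have cvg2 : (fun n => d n ^+ 2) @ \oo --> (0 ^+ 2 : R).
  by under eq_fun do rewrite expr2; rewrite expr2; apply: cvgM.
(* This is [f_le] at [u n] with the Gram form expanded around [f]; in the limit it reads
   [<f, f>^2 <= C^2 <f, f>]. *)
have cvg3 : (fun n => C ^+ 2 * (d n ^+ 2 + 2 * dotp H (kernel_comb (u n)) f
    - dotp H f f) - dotp H (kernel_comb (u n)) f ^+ 2) @ \oo -->
    (C ^+ 2 * (0 ^+ 2 + 2 * dotp H f f - dotp H f f) - dotp H f f ^+ 2).
  apply: cvgB; last by under eq_fun do rewrite expr2; rewrite expr2; apply: cvgM.
  apply: cvgM; first exact: cvg_cst.
  apply: cvgB; last exact: cvg_cst.
  by apply: cvgD => //; apply: cvgM => //; exact: cvg_cst.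
have : 0 <= C ^+ 2 * (0 ^+ 2 + 2 * dotp H f f - dotp H f f) - dotp H f f ^+ 2.
  rewrite -(cvg_lim (@Rhausdorff R) cvg3).
  apply: limr_ge; first by apply/cvg_ex; eexists; exact: cvg3.
  apply: nearW => n; rewrite /d sqr_sqrtr ?dotp_ge0//; last exact: rkhs_fun_sub.
  rewrite dotp_sub// dotp_kernel_comb_gram dotp_kernel_comb//.
  by have := f_le (u n); lra.
rewrite expr0n /= add0r => h.
rewrite -(ler_pM2r fgt0); move: h; lra.
Qed.

End Representation.

(** The representation applied to [f] itself, with its norm as [C]. *)
Lemma rkhs_comb_dense f : rkhs_fun H f -> exists u : nat -> seq (R * X),
  forall y, (fun n => kernel_comb (u n) y) @ \oo --> f y.
Proof.
move=> Hf; have f0 := sqrtr_ge0 (dotp H f f).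
have [|s|_ _ //] := rkhs_representation f0 (f := f).
  by move=> x Xx; exact: rkhs_out Hf Xx.
by rewrite sqr_sqrtr ?dotp_ge0//; exact: eval_comb_le.
Qed.

Lemma unit_ballP f : unit_ball H f <-> rkhs_fun H f /\ dotp H f f <= 1.
Proof.
have sqrt_le1 x : (Num.sqrt x <= 1 :> R) = (x <= 1).
  by rewrite -[in LHS](@sqrtr1 R) ler_sqrt.
rewrite /unit_ball /= /rkhs_norm.
by split=> -[Hf]; rewrite asboolT// lee_fin sqrt_le1.
Qed.

Lemma unit_ball0 : unit_ball H (fun=> 0).
Proof.
have H0 := rkhs0 H.
by apply/unit_ballP; split=> //; rewrite dotp0l// ler01.
Qed.

End RKHSTheory.

(* Aronszajn's inclusion theorem for the restriction to [X] of a kernel [L']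
   dominated by [L] on [X]. *)
Lemma rkhs_inclusion (R : realType) (E : Type) (X : set E) (L L' : E -> E -> R)
    (H : rkhs X L) (H' : rkhs [set: E] L') f :
  (forall s : seq (R * X), gram L' set_val s <= gram L set_val s) ->
  rkhs_fun H' f ->
  rkhs_fun H (patch (fun=> 0) X f) /\
  dotp H (patch (fun=> 0) X f) (patch (fun=> 0) X f) <= dotp H' f f.
Proof.
move=> LL' Hf; have f0 := sqrtr_ge0 (dotp H' f f).
have [||Hpf] := rkhs_representation H (f := patch (fun=> 0) X f) f0.
- by move=> x Xx; rewrite patchE memNset.
- move=> s; rewrite sqr_sqrtr ?dotp_ge0//.
  have -> : eval_comb (patch (fun=> 0) X f) s =
      eval_comb f [seq (p.1, SigSub (mem_set (I : [set: E] (set_val p.2)))) | p <- s].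
    rewrite /eval_comb big_map; apply: eq_bigr => p _.
    by rewrite patchE mem_set//; exact: set_valP.
  apply: (le_trans (eval_comb_le _ Hf)); rewrite ler_wpM2l ?dotp_ge0//.
  rewrite gram_map -map_comp; have := LL' s; rewrite gram_map.
  by [].
- by rewrite sqr_sqrtr ?dotp_ge0.
Qed.

(** * The kernel of infinitely many variables *)

Section CountableSums.
Context {R : realType} (I : countType).

(** Numbers that code no element of [I] contribute 0, so that unordered sums become ordinary
    series. *)
Definition enum_term (F : I -> R) (n : nat) : R := oapp F 0 (pickle_inv n).

Lemma esum_pickle (F : I -> \bar R) : (forall i, 0 <= F i)%E ->
  \esum_(i in [set: I]) F i = (\sum_(n <oo) oapp F 0 (pickle_inv n))%E.
Proof.
move=> F0; rewrite nneseries_esumT; last by move=> n; case: pickle_inv.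
rewrite -[RHS](_ : \esum_(n in [set choice.pickle i | i in [set: I]])
    oapp F 0%E (pickle_inv n) = _); last first.
  rewrite esum_mkcond; apply: eq_esum => n _.
  case: ifPn => //; rewrite notin_setE /= => h.
  case E : (pickle_inv n) => [i|//]; exfalso; apply: h; exists i => //.
  by have := @pickle_invK I n; rewrite E.
rewrite esum_image; last by move=> i j _ _ ij; apply: (pcan_inj (@choice.pickleK I)).
by apply: eq_esum => i _; rewrite pickleK_inv.
Qed.

Lemma enum_sum_cvg_ge0 (F : I -> R) : (forall i, 0 <= F i) ->
  (\esum_(i in [set: I]) (F i)%:E < +oo)%E ->
  (fun N => \sum_(0 <= n < N) enum_term F n) @ \oo -->
  fine (\esum_(i in [set: I]) (F i)%:E)%E.
Proof.
move=> F0 Foo.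
have e0 n : (0 <= (enum_term F n)%:E)%E.
  by rewrite lee_fin /enum_term; case: pickle_inv.
have E : \esum_(i in [set: I]) (F i)%:E = (\sum_(n <oo) (enum_term F n)%:E)%E.
  rewrite esum_pickle => [|i]; last by rewrite lee_fin.
  by apply: eq_eseriesr => n _; rewrite /enum_term; case: pickle_inv.
have fin : (\sum_(n <oo) (enum_term F n)%:E)%E \is a fin_num.
  by rewrite ge0_fin_numE ?nneseries_ge0// -E.
rewrite E; have := is_cvg_nneseries (fun n (_ : (0 <= n)%N) (_ : true) => e0 n).
rewrite -(fineK fin) => /fine_cvg; apply: cvg_trans; apply: near_eq_cvg.
by apply: nearW => N /=; rewrite sumEFin.
Qed.

(** [real_sum] is the difference of the sums of the positive and the negative parts; absolute
    summability makes both finite. *)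
Lemma enum_sum_cvg (F : I -> R) :
  (\esum_(i in [set: I]) `|F i|%:E < +oo)%E ->
  (fun N => \sum_(0 <= n < N) enum_term F n) @ \oo --> real_sum F.
Proof.
move=> Foo.
have le_oo (G : I -> R) : (forall i, G i <= `|F i|) ->
    (\esum_(i in [set: I]) (G i)%:E < +oo)%E.
  move=> GF; apply: le_lt_trans Foo; apply: le_esum => i _.
  by rewrite lee_fin.
have posE n : enum_term F n = enum_term (fun i => Num.max (F i) 0) n
    - enum_term (fun i => Num.max (- F i) 0) n.
  rewrite /enum_term; case: pickle_inv => [i|] /=; last by rewrite subrr.
  have /orP[h|h] := le_total 0 (F i).
    by rewrite max_l// max_r ?oppr_le0// subr0.
  by rewrite max_r// max_l ?oppr_ge0// sub0r opprK.
under eq_fun do rewrite (eq_bigr _ (fun n _ => posE n)) sumrB.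
apply: cvgB; apply: enum_sum_cvg_ge0 => [i|]; rewrite ?le_max ?lexx ?orbT//.
  by apply: le_oo => i; rewrite ge_max ler_norm normr_ge0.
by apply: le_oo => i; rewrite ge_max -normrN ler_norm normr_ge0.
Qed.

Lemma sum_le_enum_sum (F : I -> R) (A : seq I) (l : R) : (forall i, 0 <= F i) ->
  uniq A -> (fun N => \sum_(0 <= n < N) enum_term F n) @ \oo --> l ->
  \sum_(i <- A) F i <= l.
Proof.
move=> F0 uA cvl; rewrite -(cvg_lim (@Rhausdorff R) cvl).
apply: limr_ge; first by apply/cvg_ex; eexists; exact: cvl.
(* The partial sum over [n < N] contains all of [A] once [N] exceeds the largest code, hence the
   successor. *)
exists (\max_(i <- A) (choice.pickle i).+1)%N => // N /= AN.
have e0 n : 0 <= enum_term F n by rewrite /enum_term; case: pickle_inv.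
have -> : \sum_(i <- A) F i = \sum_(n <- map choice.pickle A) enum_term F n.
  by rewrite big_map; apply: eq_bigr => i _; rewrite /enum_term pickleK_inv.
have uB : uniq (map choice.pickle A).
  by rewrite map_inj_uniq//; exact: (pcan_inj (@choice.pickleK I)).
have : perm_eq (map choice.pickle A)
    [seq n <- index_iota 0 N | n \in map choice.pickle A].
  apply: uniq_perm => //; first exact: filter_uniq (iota_uniq _ _).
  move=> n; rewrite mem_filter mem_index_iota /= andb_idr// => /mapP[i iA ->].
  by apply: leq_trans AN; rewrite (big_rem i)//= leq_maxl.
move=> AE; rewrite (perm_big _ AE) big_filter big_mkcond /=.
by apply: ler_sum => n _; case: ifP.
Qed.

End CountableSums.

Section ProductKernels.
Context {R : realType} {d : measure_display}.
Variables (T : measurableType d) (k : T -> T -> R) (gamma : {fset nat} -> R).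
Hypothesis k_pos : positive_kernel k.
Hypothesis gamma_ge0 : forall u, 0 <= gamma u.

(** Schur product theorem, one coordinate at a time; the empty product is the constant kernel 1,
    whose Gram form is the square of the sum of the coefficients. *)
Lemma kernel_prod_positive u : positive_kernel (kernel_prod k u).
Proof.
rewrite /kernel_prod; elim: (enum_fset u) => [|j s IH].
  split=> [x y|t]; first by rewrite !big_nil.
  rewrite /gram; under eq_bigr do under eq_bigr do rewrite big_nil mulr1.
  under eq_bigr do rewrite -mulr_sumr.
  by rewrite -mulr_suml -expr2 sqr_ge0.
have := positive_kernelM (A := fun x y : sequences T => k (x j) (y j)) _ IH.
under [in X in _ -> X]eq_fun do under eq_fun do rewrite big_cons.
apply; split=> [x y|t]; first exact: k_pos.1.
rewrite (_ : gram _ _ t = gram k id [seq (p.1, p.2 j) | p <- t]); first exact: k_pos.2.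
exact: (gram_map k (fun x : sequences T => x j)).
Qed.

Lemma kernel_prod_diag_ge0 u (x : sequences T) : 0 <= kernel_prod k u x x.
Proof. exact/positive_kernel_diag_ge0/kernel_prod_positive. Qed.

(** Cauchy-Schwarz and [sqrt (a b) <= a + b]. It gives absolute convergence of the series of [K] on
    all of [frakX] x [frakX]. *)
Lemma kernel_prod_norm_le u (x y : sequences T) :
  `|kernel_prod k u x y| <= kernel_prod k u x x + kernel_prod k u y y.
Proof.
have := positive_kernel_cs2 x y (kernel_prod_positive u).
have := kernel_prod_diag_ge0 u x; have := kernel_prod_diag_ge0 u y.
move: (kernel_prod k u x x) (kernel_prod k u y y) (kernel_prod k u x y).
move=> a b c b0 a0 h; rewrite -(ger0_norm (addr_ge0 a0 b0)).
by rewrite -ler_sqr ?nnegrE// -!normrX !ger0_norm ?sqr_ge0//; nra.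
Qed.

Lemma kernel_inf_cvg x y : frakX k gamma x -> frakX k gamma y ->
  (fun N => \sum_(0 <= n < N)
     enum_term (fun u => gamma u * kernel_prod k u x y) n) @ \oo -->
  kernel_inf k gamma x y.
Proof.
move=> Xx Xy; apply: enum_sum_cvg.
have := lte_add_pinfty Xx Xy; rewrite -esumD; last 2 first.
- by move=> u _; rewrite lee_fin mulr_ge0// kernel_prod_diag_ge0.
- by move=> u _; rewrite lee_fin mulr_ge0// kernel_prod_diag_ge0.
apply: le_lt_trans; apply: le_esum => u _.
rewrite -EFinD lee_fin -mulrDr normrM (ger0_norm (gamma_ge0 u)) ler_wpM2l//.
exact: kernel_prod_norm_le.
Qed.

(** The Gram form of [K] is the sum over all [u] of the nonnegative forms of
    [gamma u * kernel_prod k u]; that of [K_v] keeps only [u] contained in [v]. This is the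
    domination asked for by [rkhs_inclusion]. *)
Lemma gram_kernel_fin_le v (s : seq (R * frakX k gamma)) :
  gram (kernel_fin k gamma v) set_val s <= gram (kernel_inf k gamma) set_val s.
Proof.
pose G u := gamma u * gram (kernel_prod k u) set_val s.
have G_ge0 u : 0 <= G u.
  by rewrite mulr_ge0// gram_map; exact: (kernel_prod_positive u).2.
have -> : gram (kernel_fin k gamma v) set_val s = \sum_(u <- fpowerset v) G u.
  rewrite /G /gram /kernel_fin; under [RHS]eq_bigr do rewrite mulr_sumr.
  rewrite [RHS]exchange_big; apply: eq_bigr => p _.
  under [RHS]eq_bigr do rewrite mulr_sumr.
  rewrite [RHS]exchange_big; apply: eq_bigr => q _.
  by rewrite mulr_sumr; apply: eq_bigr => u _; rewrite mulrCA.
apply: sum_le_enum_sum => //; first exact: fset_uniq.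
rewrite /gram; under [X in X @ _ --> _]eq_fun => N.
  rewrite (_ : \sum_(0 <= n < N) _ = \sum_(p <- s) \sum_(q <- s) p.1 * q.1 *
    \sum_(0 <= n < N) enum_term (fun u => gamma u *
       kernel_prod k u (set_val p.2) (set_val q.2)) n); last first.
    under [RHS]eq_bigr do under eq_bigr do rewrite mulr_sumr.
    under [RHS]eq_bigr do rewrite exchange_big.
    rewrite [RHS]exchange_big; apply: eq_bigr => n _.
    rewrite /enum_term; case: pickle_inv => [u|] /=; last first.
      by rewrite big1// => p _; rewrite big1// => q _; rewrite mulr0.
    rewrite /G /gram mulr_sumr; apply: eq_bigr => p _; rewrite mulr_sumr.
    by apply: eq_bigr => q _; rewrite mulrCA.
  over.
apply: cvg_big => [|p _]; first by apply: add_continuous.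
apply: cvg_big => [|q _]; first by apply: add_continuous.
apply: cvgM; first exact: cvg_cst.
by apply: kernel_inf_cvg; exact: set_valP.
Qed.

End ProductKernels.

(** * Moments of a product measure *)

Section ProductMeasure.
Context {R : realType} {d : measure_display}.
Variables (T : measurableType d) (rho : probability T R).
Variables (mu : probability (sequences T) R).
Hypothesis mu_prod : is_product_measure rho mu.

Lemma measurable_coordinate j :
  measurable_fun [set: sequences T] (fun x : sequences T => x j).
Proof.
move=> _ A mA; rewrite setTI; apply: sub_sigma_algebra.
by exists j, A; split.
Qed.

(** A Tonelli step in one coordinate: the identity for indicators passes to simple functions by
    linearity and to [g] by monotone convergence. *)
Lemma integral_coordinate_mul (j : nat) (w : sequences T -> R) (g : T -> R) (c : R) :
  measurable_fun setT w -> (forall x, 0 <= w x) ->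
  measurable_fun setT g -> (forall y, 0 <= g y) ->
  (forall A, measurable A ->
    \int[mu]_x (\1_A (x j) * w x)%:E = rho A * c%:E)%E ->
  (\int[mu]_x (g (x j) * w x)%:E = (\int[rho]_y (g y)%:E) * c%:E)%E.
Proof.
move=> mw w0 mg g0 wA.
have mj := measurable_coordinate j.
have mgE : measurable_fun setT (fun y => (g y)%:E) by exact/measurable_EFinP.
pose h := nnsfun_approx measurableT mgE.
have h_cvg y : (fun n => (h n y)%:E) @ \oo --> (g y)%:E.
  by apply: (cvg_nnsfun_approx measurableT mgE) => // z _; rewrite lee_fin.
have h_homo y : {homo (fun n => h n y) : m n / (m <= n)%N >-> m <= n}.
  by move=> m n mn; have /lefP := nd_nnsfun_approx measurableT mgE mn; exact.
have h_ge0 n y : 0 <= h n y by exact: fun_ge0.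
have mhw n : measurable_fun setT (fun x : sequences T => (h n (x j) * w x)%:E).
  apply/measurable_EFinP/measurable_funM => //.
  exact: (measurableT_comp (measurable_funP (h n)) mj).
have simple n : (\int[mu]_x (h n (x j) * w x)%:E =
    (\int[rho]_y (h n y)%:E) * c%:E)%E.
  pose s := fset_set (range (h n)).
  have s0 (i : 'I_#|` s|) : 0 <= s`_i.
    have : s`_i \in s by exact: mem_nth.
    by rewrite in_fset_set// inE => -[y _ <-].
  have mI (A : set T) : measurable A ->
      measurable_fun setT (fun x : sequences T => \1_A (x j) : R).
    by move=> mA; exact: (measurableT_comp (measurable_indic mA) mj).
  transitivity (\sum_(i < #|` s|) (s`_i)%:E *
      \int[mu]_x (\1_(h n @^-1` [set s`_i]) (x j) * w x)%:E)%E.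
    rewrite (eq_integral (fun x : sequences T => \sum_(i < #|` s|) (s`_i *
        (\1_(h n @^-1` [set s`_i]) (x j) * w x))%:E)%E) => [|x _]; last first.
      by rewrite sumEFin fimfunEord mulr_suml; under eq_bigr do rewrite -mulrA.
    rewrite ge0_integral_sum//.
    - apply: eq_bigr => i _; rewrite -ge0_integralZl//.
      + by apply/measurable_EFinP/measurable_funM => //; exact: mI.
      + by move=> x _; rewrite lee_fin mulr_ge0.
      + by rewrite lee_fin.
    - move=> i; apply/measurable_EFinP/measurable_funM => //.
      by apply/measurable_funM => //; exact: mI.
    - by move=> i x _; rewrite lee_fin mulr_ge0// mulr_ge0.
  under eq_bigr do rewrite wA// muleA.
  rewrite -ge0_sume_distrl => [|i _]; last by rewrite mule_ge0// lee_fin.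
  congr (_ * _)%E; rewrite (eq_integral (fun y => \sum_(i < #|` s|) (s`_i *
        \1_(h n @^-1` [set s`_i]) y)%:E)%E) => [|y _]; last first.
    by rewrite sumEFin fimfunEord.
  rewrite ge0_integral_sum//.
  - apply: eq_bigr => i _.
    under eq_integral do rewrite EFinM.
    rewrite ge0_integralZl// ?lee_fin//; last by apply/measurable_EFinP.
    by rewrite integral_indic// setIT.
  - by move=> i; apply/measurable_EFinP/measurable_funM.
  - by move=> i x _; rewrite lee_fin mulr_ge0.
have -> : (\int[rho]_y (g y)%:E = limn (fun n => \int[rho]_y (h n y)%:E))%E.
  rewrite -monotone_convergence//.
  - by apply: eq_integral => y _; apply/esym/cvg_lim => //; exact: h_cvg.
  - by move=> n; exact/measurable_EFinP.
  - by move=> n y _; rewrite lee_fin.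
  - by move=> y _ m n mn; rewrite lee_fin h_homo.
have -> : (\int[mu]_x (g (x j) * w x)%:E =
    limn (fun n => \int[mu]_x (h n (x j) * w x)%:E))%E.
  rewrite -monotone_convergence//.
  - apply: eq_integral => x _; apply/esym/cvg_lim => //.
    have -> : (g (x j) * w x)%:E = ((g (x j))%:E * (w x)%:E)%E by [].
    under eq_fun do rewrite EFinM; apply: cvgeZr => //; exact: h_cvg.
  - by move=> n x _; rewrite lee_fin mulr_ge0.
  - by move=> x _ m n mn; rewrite lee_fin ler_wpM2r// h_homo.
under eq_fun do rewrite simple.
apply/cvg_lim => //; apply: cvgeZr => //.
apply: ereal_nondecreasing_is_cvgn => m n mn; apply: ge0_le_integral => //.
- by move=> y _; rewrite lee_fin.
- exact/measurable_EFinP.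
- exact/measurable_EFinP.
- by move=> y _; rewrite lee_fin h_homo.
Qed.

End ProductMeasure.

Section ProductMoments.
Context {R : realType} {d : measure_display}.
Variables (T : measurableType d) (rho : probability T R).
Variables (mu : probability (sequences T) R).
Hypothesis mu_prod : is_product_measure rho mu.

Lemma measurable_prod_coordinates (g : T -> R) (s : seq nat) :
  measurable_fun setT g ->
  measurable_fun setT (fun x : sequences T => \prod_(j <- s) g (x j)).
Proof.
move=> mg; apply: measurable_prod => j _.
exact: (measurableT_comp mg (measurable_coordinate j)).
Qed.

(** The indicator factors carry the induction on [s]: testing coordinate [i] on a set [B] moves [i]
    from [s] to [J]. *)
Lemma integral_prod_coordinates_indic (g : T -> R) (M : R) (s : seq nat)
    (J : {fset nat}) (A : nat -> set T) :
  measurable_fun setT g -> (forall y, 0 <= g y) ->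
  (\int[rho]_y (g y)%:E = M%:E)%E ->
  uniq s -> (forall j, j \in s -> j \notin J) -> (forall j, measurable (A j)) ->
  (\int[mu]_x (\prod_(j <- s) g (x j) * \prod_(j <- J) \1_(A j) (x j))%:E =
   (M ^+ size s * \prod_(j <- J) fine (rho (A j)))%:E)%E.
Proof.
move=> mg g0 gM; elim: s J A => [|i s IH] J A.
  move=> _ _ mA; rewrite expr0 mul1r -mu_prod//.
  pose C := [set x : sequences T | forall j, j \in J -> A j (x j)].
  have mC : measurable C.
    rewrite (_ : C = \bigcap_(j in [set` J]) [set x : sequences T | A j (x j)]).
      apply: bigcap_measurableType => j _; apply: sub_sigma_algebra.
      by exists j, (A j).
    by apply/seteqP; split=> x /= h j; exact: h.
  rewrite -[RHS](_ : \int[mu]_x (\1_C x)%:E = _)%E; last first.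
    by rewrite integral_indic// setIT.
  apply: eq_integral => x _; rewrite big_nil mul1r; congr _%:E.
  rewrite indicE; case: (asboolP (C x)) => Cx.
    rewrite mem_set// big_seq big1// => j jJ; rewrite indicE mem_set//.
    exact: Cx.
  rewrite memNset//; have /existsNP[j /not_implyP [jJ Aj]] := Cx.
  by rewrite (big_fsetD1 j)//= indicE memNset// mul0r.
rewrite cons_uniq => /andP[iNs us] sJ mA.
pose w (x : sequences T) := \prod_(j <- s) g (x j) * \prod_(j <- J) \1_(A j) (x j).
have w0 x : 0 <= w x by rewrite mulr_ge0// prodr_ge0.
have mw : measurable_fun setT w.
  apply: measurable_funM; first exact: measurable_prod_coordinates.
  apply: measurable_prod => j _.
  exact: (measurableT_comp (measurable_indic (mA j)) (measurable_coordinate j)).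
have iJ : i \notin J by apply: sJ; rewrite mem_head.
transitivity (\int[mu]_x (g (x i) * w x)%:E)%E.
  by apply: eq_integral => x _; rewrite big_cons /w mulrA.
rewrite (integral_coordinate_mul (rho := rho) mw w0 mg g0
  (c := M ^+ size s * \prod_(j <- J) fine (rho (A j)))).
  by rewrite gM -EFinM mulrA -exprS.
move=> B mB; pose A' j := if j == i then B else A j.
have mA' j : measurable (A' j) by rewrite /A'; case: ifP.
have sJ' j : j \in s -> j \notin (i |` J)%fset.
  move=> js; rewrite in_fset1U negb_or sJ ?andbT ?in_cons ?js ?orbT//.
  by apply: contraNneq iNs => <-.
have A'E j : j \in J -> A' j = A j.
  by move=> jJ; rewrite /A'; case: eqP => // ji; move: jJ; rewrite ji (negbTE iJ).
have A'i : A' i = B by rewrite /A' eqxx.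
transitivity (\int[mu]_x (\prod_(j <- s) g (x j) *
    \prod_(j <- (i |` J)%fset) \1_(A' j) (x j))%:E)%E.
  apply: eq_integral => x _; rewrite big_fsetU1//= A'i /w mulrCA.
  congr (_ * (_ * _))%:E; rewrite big_seq [RHS]big_seq.
  by apply: eq_bigr => j jJ; rewrite A'E.
rewrite IH// big_fsetU1//= A'i mulrCA EFinM fineK ?fin_num_measure//.
by rewrite big_seq [in RHS]big_seq; under eq_bigr => j jJ do rewrite A'E//.
Qed.

Lemma integral_prod_coordinates (g : T -> R) (M : R) (s : seq nat) :
  measurable_fun setT g -> (forall y, 0 <= g y) ->
  (\int[rho]_y (g y)%:E = M%:E)%E -> uniq s ->
  (\int[mu]_x (\prod_(j <- s) g (x j))%:E = (M ^+ size s)%:E)%E.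
Proof.
move=> mg g0 gM us.
have := integral_prod_coordinates_indic (J := fset0) (A := fun=> setT) mg g0 gM us.
rewrite !big_seq_fset0 mulr1 => <- //.
by apply: eq_integral => x _; rewrite big_seq_fset0 mulr1.
Qed.

End ProductMoments.

(** * Integrability on [H(K)] *)

Section TensorSpace.
Context {R : realType} {d : measure_display}.
Variables (T : measurableType d) (rho : probability T R).
Variables (mu : probability (sequences T) R).
Hypothesis mu_prod : is_product_measure rho mu.
Variables (k : T -> T -> R) (gamma : {fset nat} -> R).
Hypothesis k_pos : positive_kernel k.
Hypothesis k_meas : measurable_fun [set: T * T] (fun z => k z.1 z.2).
Hypothesis gamma_ge0 : forall u, 0 <= gamma u.
Hypothesis k_moment : (diag_moment rho k < +oo)%E.
Hypothesis gamma_sum : (\esum_(u in [set: {fset nat}])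
  ((gamma u)%:E * diag_moment rho k ^+ #|` u|) < +oo)%E.
Variable HK : rkhs (frakX k gamma) (kernel_inf k gamma).

Let X := frakX k gamma.

Let diag_sum (x : sequences T) : \bar R :=
  \esum_(u in [set: {fset nat}]) (gamma u * kernel_prod k u x x)%:E.

Let diag_term (n : nat) (x : sequences T) : \bar R :=
  oapp (fun u : {fset nat} => (gamma u * kernel_prod k u x x)%:E) 0%E (pickle_inv n).

Let term_ge0 u (x : sequences T) : 0 <= gamma u * kernel_prod k u x x.
Proof. by rewrite mulr_ge0//; exact: kernel_prod_diag_ge0. Qed.

Let diag_term_ge0 n x : (0 <= diag_term n x)%E.
Proof. by rewrite /diag_term; case: pickle_inv => //= u; rewrite lee_fin. Qed.

Let diag_sumE x : diag_sum x = (\sum_(n <oo) diag_term n x)%E.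
Proof. by rewrite /diag_sum esum_pickle// => u; rewrite lee_fin. Qed.

Let measurable_diag : measurable_fun setT (fun y : T => k y y).
Proof.
exact: (measurableT_comp k_meas
  (measurable_fun_pair (@measurable_id _ T setT) (@measurable_id _ T setT))).
Qed.

Let measurable_kernel_prod_diag u :
  measurable_fun setT (fun x : sequences T => kernel_prod k u x x).
Proof. exact: (measurable_prod_coordinates _ measurable_diag). Qed.

Let measurable_diag_term n : measurable_fun setT (diag_term n).
Proof.
rewrite /diag_term; case: pickle_inv => [u|] /=; last exact: measurable_cst.
apply/measurable_EFinP; apply: measurable_funM => //.
Qed.

Let measurable_diag_sum : measurable_fun setT diag_sum.
Proof.
rewrite (_ : diag_sum = fun x => (\sum_(n <oo) diag_term n x)%E); last first.
  by apply: funext => x; exact: diag_sumE.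
exact: (ge0_emeasurable_sum (P := xpredT)).
Qed.

Lemma measurable_frakX : measurable X.
Proof.
rewrite -[X]setTI; apply: emeasurable_fun_infty_o => //.
Qed.

Let kernel_inf_diag x : X x -> (kernel_inf k gamma x x)%:E = diag_sum x.
Proof.
move=> Xx; rewrite -[RHS]fineK; last first.
  by rewrite ge0_fin_numE ?esum_ge0// => u _; rewrite lee_fin.
congr _%:E; apply: (cvg_unique _ (kernel_inf_cvg k_pos gamma_ge0 Xx Xx)).
  exact: Rhausdorff.
exact: enum_sum_cvg_ge0.
Qed.

(** Integration term by term: the diagonal of [kernel_prod k u] has integral [M^|u|], which leads to
    the summability condition on the weights. *)
Let integral_diag_sum : (\int[mu]_x diag_sum x < +oo)%E.
Proof.
under eq_integral do rewrite diag_sumE.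
rewrite integral_nneseries//; apply: le_lt_trans gamma_sum.
have M_ge0 : (0 <= diag_moment rho k)%E.
  by apply: integral_ge0 => y _; rewrite lee_fin positive_kernel_diag_ge0.
have M_fin : diag_moment rho k \is a fin_num by rewrite ge0_fin_numE.
have t0 u : (0 <= (gamma u)%:E * diag_moment rho k ^+ #|` u|)%E.
  by rewrite mule_ge0 ?lee_fin ?expe_ge0.
rewrite esum_pickle//; apply: lee_nneseries => [n _ _|n _].
  by apply: integral_ge0 => x _; exact: diag_term_ge0.
rewrite /diag_term; case: pickle_inv => [u|] /=; last by rewrite integral0.
rewrite (eq_integral (fun x : sequences T =>
    ((gamma u)%:E * (kernel_prod k u x x)%:E)%E)) => [|x _]; last by rewrite EFinM.
rewrite ge0_integralZl ?lee_fin//.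
- have kM : (\int[rho]_y (k y y)%:E = (fine (diag_moment rho k))%:E)%E.
    by rewrite fineK.
  have k0 y : 0 <= k y y by exact: positive_kernel_diag_ge0.
  rewrite [X in (_ * X <= _)%E](integral_prod_coordinates mu_prod
    measurable_diag k0 kM (fset_uniq u)).
  by rewrite EFin_expe fineK.
- exact/measurable_EFinP.
- by move=> x _; rewrite lee_fin; exact: kernel_prod_diag_ge0.
Qed.

Lemma measurable_kernel_inf y : X y ->
  measurable_fun X (fun x => kernel_inf k gamma x y).
Proof.
move=> Xy; apply: (measurable_fun_cvg (h := fun N x => \sum_(0 <= n < N)
    enum_term (fun u => gamma u * kernel_prod k u x y) n)).
  move=> N; apply: measurable_sum => n; apply: measurable_funTS.
  rewrite /enum_term; case: pickle_inv => [u|] /=; last exact: measurable_cst.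
  apply: measurable_funM => //; apply: measurable_prod => j _.
  exact: (measurableT_comp (measurable_fun_pair1 (y j) k_meas)
    (measurable_coordinate j)).
by move=> x Xx; exact: kernel_inf_cvg.
Qed.

(** Functions of [H(K)] are pointwise limits of combinations of kernel sections, which are
    measurable. *)
Lemma rkhs_frakX_measurable f : rkhs_fun HK f -> measurable_fun X f.
Proof.
move=> /rkhs_comb_dense[u uf].
apply: (measurable_fun_cvg (h := fun n (x : sequences T) =>
  kernel_comb (kernel_inf k gamma) (u n) x)) => // n.
apply: measurable_sum => p; apply: measurable_funM => //.
apply: (eq_measurable_fun (fun x => kernel_inf k gamma x (set_val p.2))).
  by move=> x /set_mem Xx; rewrite patchE mem_set.
by apply: measurable_kernel_inf; exact: set_valP.
Qed.

(** On [frakX], [|f x| <= |f| sqrt (K x x) <= |f| (1 + K x x)], and the diagonal of [K] has finite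
    integral. *)
Lemma rkhs_frakX_integrable f : rkhs_fun HK f -> mu.-integrable X (EFin \o f).
Proof.
move=> Hf; have mX := measurable_frakX.
have mf : measurable_fun X (EFin \o f).
  by apply/measurable_EFinP; exact: rkhs_frakX_measurable.
apply/integrableP; split=> //.
set C := Num.sqrt (dotp HK f f).
have C0 : 0 <= C by exact: sqrtr_ge0.
have d0 x : (0 <= diag_sum x)%E by rewrite diag_sumE nneseries_ge0.
have m1 : measurable_fun setT (fun x : sequences T => 1 + diag_sum x)%E.
  exact: emeasurable_funD.
apply: (@le_lt_trans _ _ (\int[mu]_(x in X) (C%:E * (1 + diag_sum x)))%E).
  apply: ge0_le_integral => //.
  - exact: measurableT_comp mf.
  - by apply: measurable_funTS; exact: measurable_funeM.
  - move=> x Xx; rewrite -kernel_inf_diag//= -EFinD -EFinM lee_fin.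
    apply: (le_trans (rkhs_eval_le Hf Xx)); rewrite ler_wpM2l//.
    have K0 : 0 <= kernel_inf k gamma x x by rewrite -lee_fin kernel_inf_diag.
    have := sqr_sqrtr K0; move: (Num.sqrt _) (sqrtr_ge0 (kernel_inf k gamma x x)).
    by move=> t t0 <-; nra.
apply: (@le_lt_trans _ _ (\int[mu]_x (C%:E * (1 + diag_sum x)))%E).
  apply: ge0_subset_integral => //; first exact: measurable_funeM.
  by move=> x _; rewrite mule_ge0 ?lee_fin ?adde_ge0.
rewrite ge0_integralZl//; last by move=> x _; rewrite adde_ge0.
rewrite ge0_integralD// integral_cst//= mul1e probability_setT.
by rewrite lte_mul_pinfty// ?lee_fin// lte_add_pinfty// ltry.
Qed.

Lemma rkhs_frakX_inclusion v (Hv : rkhs [set: sequences T] (kernel_fin k gamma v)) f :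
  rkhs_fun Hv f ->
  rkhs_fun HK (patch (fun=> 0) X f) /\
  dotp HK (patch (fun=> 0) X f) (patch (fun=> 0) X f) <= dotp Hv f f.
Proof. by apply: rkhs_inclusion => s; exact: gram_kernel_fin_le. Qed.

End TensorSpace.

(** * Randomized algorithms *)

(** The integral of a nonnegative function is a supremum over simple functions below it, so
    monotonicity holds for arbitrary such functions, in particular for the cost of a run under a
    general [c]. *)
Lemma ge0_le_integralT (R : realType) (d : measure_display) (T : measurableType d)
    (mu : measure T R) (f g : T -> \bar R) :
  (forall x, (0 <= f x)%E) -> (forall x, (f x <= g x)%E) ->
  (\int[mu]_x f x <= \int[mu]_x g x)%E.
Proof.
move=> f0 fg; rewrite !ge0_integralTE//; last by move=> x; exact: le_trans (fg x).
apply: le_ereal_sup => _ [h hf <-]; exists h => // x.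
exact: le_trans (hf x) (fg x).
Qed.

Section Algorithms.
Context {R : realType} {d : measure_display} (E : measurableType d).
Implicit Types (Q : rand_alg (R := R) E) (f g : E -> R) (F : set (E -> R)).

(* The history on [patch (fun=> 0) X f] is recovered from the one on [f], so that
   [restrict_alg X Q] runs on [f] exactly as [Q] does on [patch (fun=> 0) X f]. *)
Definition zero_outside (X : set E) (next : seq R -> option E) (h : seq R) : seq R :=
  foldl (fun h' y => rcons h'
    (if next h' is Some x then if x \in X then y else 0 else y)) [::] h.

Definition restrict_alg (X : set E) Q : rand_alg (R := R) E :=
  RandAlg (alg_prob Q)
    (fun w h => next_point w (zero_outside X (next_point w) h))
    (fun w h => output w (zero_outside X (next_point w) h)).

Section Restriction.
Variables (X : set E) (Q : rand_alg (R := R) E) (f : E -> R).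

Lemma history_restrict_alg (w : alg_space Q) n :
  zero_outside X (next_point w) (history (Q := restrict_alg X Q) f w n) =
  history (patch (fun=> 0) X f) w n.
Proof.
elim: n => //= n IH; rewrite IH; case E1 : (next_point _ _) => [x|]; last exact: IH.
by rewrite /zero_outside foldl_rcons -/(zero_outside _ _ _) IH E1 patchE.
Qed.

Lemma point_restrict_alg :
  Defs.point (Q := restrict_alg X Q) f = Defs.point (Q := Q) (patch (fun=> 0) X f).
Proof.
by apply: funext => w; apply: funext => n; rewrite /Defs.point /= history_restrict_alg.
Qed.

Lemma result_restrict_alg :
  result (Q := restrict_alg X Q) f = result (Q := Q) (patch (fun=> 0) X f).
Proof.
apply: funext => w; rewrite /result point_restrict_alg /=.
by rewrite history_restrict_alg.
Qed.

Lemma expected_cost_restrict_alg c :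
  expected_cost c (restrict_alg X Q) f = expected_cost c Q (patch (fun=> 0) X f).
Proof.
apply: eq_integral => w _; rewrite /eval_cost.
by apply: eq_eseriesr => n _; rewrite point_restrict_alg.
Qed.

End Restriction.

Lemma restrict_alg_for X Q F F' :
  (forall f, F' f -> F (patch (fun=> 0) X f)) ->
  algorithm_for F Q -> algorithm_for F' (restrict_alg X Q).
Proof.
move=> FF' QF f /FF'/QF[term mres mpt].
have pE := point_restrict_alg X Q f; split.
- by move=> w; have [n nP] := term w; exists n; rewrite -nP -pE.
- by rewrite result_restrict_alg.
- by move=> n B mB; have := mpt n B mB; rewrite -pE.
Qed.

Definition mean_square_error (I : (E -> R) -> R) Q F : \bar R :=
  ereal_sup [set \int[alg_prob Q]_w ((I f - result f w) ^+ 2)%:E | f in F]%E.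

Lemma mean_square_error_ge0 I Q F f : F f -> (0 <= mean_square_error I Q F)%E.
Proof.
move=> Ff; apply: le_ereal_sup_tmp; eexists; first by exists f.
by apply: integral_ge0 => w _; rewrite lee_fin sqr_ge0.
Qed.

Lemma sqrt_le_error I Q F (a : R) : 0 <= a ->
  (a%:E <= mean_square_error I Q F)%E -> ((Num.sqrt a)%:E <= error I Q F)%E.
Proof.
move=> a0 am; have m0 : (0 <= mean_square_error I Q F)%E.
  by apply: le_trans am; rewrite lee_fin.
have -> : (Num.sqrt a)%:E = (a%:E `^ 2^-1)%E by rewrite poweR_EFin powR12_sqrt.
by apply: gt0_ler_poweR; rewrite ?in_itv/= ?lee_fin ?leey ?andbT.
Qed.

Lemma error_restrict_alg_le I X Q F F' f0 : F' f0 ->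
  (forall f, F' f -> F (patch (fun=> 0) X f)) ->
  (forall f, F' f -> I (patch (fun=> 0) X f) = I f) ->
  (error I (restrict_alg X Q) F' <= error I Q F)%E.
Proof.
move=> Ff0 FF' II.
have sub : (mean_square_error I (restrict_alg X Q) F' <= mean_square_error I Q F)%E.
  apply: le_ereal_sup => _ [f Ff <-]; exists (patch (fun=> 0) X f); first exact: FF'.
  by rewrite II// result_restrict_alg.
have m0 := mean_square_error_ge0 I (restrict_alg X Q) Ff0.
apply: gt0_ler_poweR => //; rewrite in_itv/= leey andbT//.
exact: le_trans m0 sub.
Qed.

Definition escape (S : set E) Q f : set (alg_space Q) :=
  [set w | exists n, exists2 x, Defs.point f w n = Some x & ~ S x].

(** * Cost of a run and inputs that a run cannot distinguish *)

Section Cost.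
Variables (Q : rand_alg (R := R) E) (F : set (E -> R)).
Hypothesis QF : algorithm_for F Q.

Lemma measurable_escape (S : set E) f : measurable S -> F f ->
  measurable (escape S (Q := Q) f).
Proof.
move=> mS Ff; rewrite (_ : escape S f = \bigcup_n
    [set w | exists2 x, Defs.point f w n = Some x & (~` S) x]).
  by apply: bigcupT_measurable => n; have [_ _] := QF Ff; apply; exact: measurableC.
by apply/seteqP; split=> w [n]; [exists n|move=> _; exists n].
Qed.

Let cost_term (c : E -> \bar R) f (w : alg_space Q) n : \bar R :=
  if Defs.point f w n is Some x then c x else 0%E.

(** Markov's inequality: a run that leaves [S] pays at least [t] for some evaluation. *)
Lemma escape_prob_le (c : E -> \bar R) (S : set E) f (t B : R) :
  measurable S -> F f -> 0 <= t -> (forall x, (0 <= c x)%E) ->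
  (forall x, ~ S x -> (t%:E <= c x)%E) ->
  (expected_cost c Q f <= B%:E)%E ->
  (t%:E * alg_prob Q (escape S f) <= B%:E)%E.
Proof.
move=> mS Ff t0 c0 cS; apply: le_trans.
have mA := measurable_escape mS Ff.
have -> : (t%:E * alg_prob Q (escape S f) =
    \int[alg_prob Q]_w (t%:E * (\1_(escape S f) w)%:E))%E.
  rewrite ge0_integralZl// ?lee_fin// ?integral_indic// ?setIT//.
  exact/measurable_EFinP.
apply: ge0_le_integralT => w; first by rewrite mule_ge0.
have e0 n : (0 <= cost_term c f w n)%E by rewrite /cost_term; case: Defs.point.
rewrite indicE; case: (asboolP (escape S f w)) => wA.
  rewrite mem_set// mule1; have [n [x px Sx]] := wA.
  apply: (le_trans (cS _ Sx)).
  (* The partial sum up to [n.+1] contains the offending [n]-th evaluation. *)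
  have := nneseries_lim_ge n.+1 (fun n (_ : (0 <= n)%N) (_ : true) => e0 n).
  apply: le_trans; rewrite big_nat_recr//= /cost_term px leeDr//.
  by apply: sume_ge0 => i _; exact: e0.
rewrite memNset// mule0; apply: nneseries_ge0 => n _ _; exact: e0.
Qed.

(** Run by run, [t] times the number of evaluations is at most the cost. The number is measurable by
    [algorithm_for], which lets [t] be taken out of the integral. *)
Lemma expected_evals_le (c : E -> \bar R) f (t B : R) :
  F f -> 0 < t -> (forall x, (t%:E <= c x)%E) ->
  (expected_cost c Q f <= B%:E)%E -> (expected_evals Q f <= (B / t)%:E)%E.
Proof.
move=> Ff t0 ct cB.
have e0 n w : (0 <= cost_term (fun=> 1%E) f w n)%E.
  by rewrite /cost_term; case: Defs.point.
have me n : measurable_fun setT (fun w => cost_term (fun=> 1%E) f w n).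
  pose A := [set w | exists2 x, Defs.point (Q := Q) f w n = Some x & [set: E] x].
  have mA : measurable A by have [_ _] := QF Ff; apply.
  rewrite (_ : (fun w => _) = (fun w => (\1_A w)%:E)).
    by apply/measurable_EFinP; exact: measurable_indic.
  apply: funext => w; rewrite indicE /cost_term; case pw : Defs.point => [x|].
    by rewrite mem_set//; exists x.
  by rewrite memNset// => -[x]; rewrite pw.
have mev : measurable_fun setT (eval_cost (fun=> 1%E) (Q := Q) f).
  apply: (ge0_emeasurable_sum (P := xpredT)) => [n w _ _|n _].
    exact: e0.
  exact: me.
have : (t%:E * expected_evals Q f <= B%:E)%E.
  apply: le_trans cB; rewrite /expected_evals /expected_cost -ge0_integralZl//.
  - apply: ge0_le_integralT => w.
      rewrite mule_ge0 ?lee_fin ?(ltW t0)//.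
      by apply: nneseries_ge0 => n _ _; exact: e0.
    rewrite /eval_cost -nneseriesZl => [|n _]; last exact: e0.
    apply: lee_nneseries => [n _ _|n _].
      by rewrite mule_ge0 ?lee_fin ?(ltW t0)//; exact: e0.
    by case: Defs.point => [x|]; rewrite ?mule1 ?mule0.
  - by move=> w _; apply: nneseries_ge0 => n _ _; exact: e0.
  - by rewrite lee_fin ltW.
by rewrite [B / t]mulrC EFinM lee_pdivlMl.
Qed.

(** As long as the points stay in [S], every computed value is 0 for both inputs, so the histories
    agree step by step. *)
Lemma result_eq_notin_escape (S : set E) g g' (w : alg_space Q) :
  (forall x, S x -> g x = 0) -> (forall x, S x -> g' x = 0) ->
  ~ escape S g w -> result g w = result g' w.
Proof.
move=> g0 g'0 wS.
have hE n : history g w n = history g' w n.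
  elim: n => //= n IH; rewrite -IH; case E1 : next_point => [x|//].
  have Sx : S x by apply: contrapT => Sx; apply: wS; exists n, x.
  by rewrite g0// g'0.
have pE : Defs.point g w = Defs.point g' w by apply: funext => n; rewrite /Defs.point hE.
by rewrite /result pE hE.
Qed.

(** Off the escape event both inputs give the same result [q], and
    [(I g - q)^2 + (- I g - q)^2 >= 2 (I g)^2]. This happens with probability at least 1/2, so the
    two mean square errors add up to at least [(I g)^2]. *)
Lemma mean_square_error_ge_escape I (S : set E) g g' :
  measurable S -> F g -> F g' -> I g' = - I g ->
  (forall x, S x -> g x = 0) -> (forall x, S x -> g' x = 0) ->
  (alg_prob Q (escape S g) <= (2^-1)%:E)%E ->
  ((I g ^+ 2 / 2)%:E <= mean_square_error I Q F)%E.
Proof.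
move=> mS Fg Fg' Ig' g0 g'0 PS.
have mA := measurable_escape mS Fg.
set e := mean_square_error I Q F.
have le_e f : F f -> (\int[alg_prob Q]_w ((I f - result f w) ^+ 2)%:E <= e)%E.
  by move=> Ff; apply: ereal_sup_ubound; exists f.
have mr f : F f -> measurable_fun setT
    (fun w : alg_space Q => ((I f - result f w) ^+ 2)%:E).
  move=> Ff; have [_ mres _] := QF Ff.
  by apply/measurable_EFinP/measurable_funX/measurable_funB.
have : ((I g ^+ 2)%:E <= e + e)%E.
  apply: le_trans (leeD (le_e _ Fg) (le_e _ Fg')).
  rewrite -ge0_integralD//; last 4 first.
  - by move=> w _; rewrite lee_fin sqr_ge0.
  - exact: mr.
  - by move=> w _; rewrite lee_fin sqr_ge0.
  - exact: mr.
  apply: (@le_trans _ _ (\int[alg_prob Q]_w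
      ((2 * I g ^+ 2)%:E * (\1_(~` escape S g) w)%:E))%E).
    have mC := measurableC mA.
    have mI : measurable_fun setT
        (fun w : alg_space Q => (\1_(~` escape S g) w : R)%:E).
      by apply/measurable_EFinP; exact: measurable_indic.
    rewrite ge0_integralZl//; last by rewrite lee_fin mulr_ge0// sqr_ge0.
    rewrite integral_indic// setIT.
    have PC := probability_setC (alg_prob Q) mA.
    suff : ((I g ^+ 2)%:E <= (2 * I g ^+ 2)%:E * (1 - alg_prob Q (escape S g)))%E.
      by rewrite -PC.
    have : alg_prob Q (escape S g) \is a fin_num by exact: fin_num_measure.
    move: PS; case: (alg_prob Q _) => // r; rewrite lee_fin => rle _.
    rewrite -EFinB -EFinM lee_fin; have := sqr_ge0 (I g); nra.
  apply: ge0_le_integralT => w.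
    by rewrite mule_ge0 ?lee_fin// mulr_ge0// sqr_ge0.
  rewrite indicE; case: (asboolP (escape S g w)) => wA.
    rewrite memNset ?mule0; last by move=> /(_ wA).
    by rewrite adde_ge0// lee_fin sqr_ge0.
  rewrite mem_set// mule1 -EFinD lee_fin Ig' (result_eq_notin_escape g0 g'0 wA).
  by have := sqr_ge0 (result g' w); lra.
have : (0 <= e)%E by exact: mean_square_error_ge0 Fg.
case: e {le_e} => [r _|_ _|//]; last by rewrite leey.
by rewrite -EFinD !lee_fin ler_pdivrMr//; lra.
Qed.

End Cost.

End Algorithms.

(** * Lower bounds *)

Lemma ler_powRN (R : realType) (x y r : R) :
  0 < x -> x <= y -> 0 <= r -> y `^ (- r) <= x `^ (- r).
Proof.
move=> x0 xy r0; have y0 := lt_le_trans x0 xy.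
rewrite !powRN lef_pV2 ?posrE ?powR_gt0//.
by apply: ge0_ler_powR; rewrite ?nnegrE ?(ltW x0) ?(ltW y0).
Qed.

Lemma le_expe2_sqrt (R : realType) (a : R) (e : \bar R) : 0 <= a ->
  ((Num.sqrt a)%:E <= e)%E -> (a%:E <= e ^+ 2)%E.
Proof.
move=> a0; case: e => [r| |//]; last by move=> _; rewrite expe2 mulyy leey.
rewrite lee_fin => ar; rewrite -EFin_expe lee_fin -[a]sqr_sqrtr//.
by rewrite ler_sqr ?nnegrE ?sqrtr_ge0// (le_trans _ ar) ?sqrtr_ge0.
Qed.

Lemma sqrt_le_expe2 (R : realType) (a : R) (e : \bar R) : (0 <= e)%E ->
  (a%:E <= e ^+ 2)%E -> ((Num.sqrt a)%:E <= e)%E.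
Proof.
case: e => [r| |//]; last by move=> *; rewrite leey.
rewrite -EFin_expe !lee_fin => r0 ar.
by rewrite -[leRHS]ger0_norm// -sqrtr_sqr ler_wsqrtr.
Qed.

Lemma measurable_anchored_set (d : measure_display) (T : measurableType d)
    (v : {fset nat}) (a : sequences T) :
  (forall y : T, measurable [set y]) -> measurable (anchored_set v a).
Proof.
move=> m1; rewrite (_ : anchored_set v a =
    \bigcap_(j in [set j | j \notin v]) [set x : sequences T | [set a j] (x j)]).
  apply: bigcap_measurableType => j _; apply: sub_sigma_algebra.
  by exists j, [set a j].
by apply/seteqP; split=> x /= h j; exact: h.
Qed.

Section LowerBounds.
Context {R : realType} {d : measure_display}.
Variables (T : measurableType d) (rho : probability T R).
Variables (mu : probability (sequences T) R).
Hypothesis mu_prod : is_product_measure rho mu.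
Hypothesis measurable_point : forall y : T, measurable [set y].
Variables (k : T -> T -> R) (gamma : {fset nat} -> R).
Hypothesis k_pos : positive_kernel k.
Hypothesis k_meas : measurable_fun [set: T * T] (fun z => k z.1 z.2).
Hypothesis gamma_ge0 : forall u, 0 <= gamma u.
Hypothesis k_moment : (diag_moment rho k < +oo)%E.
Hypothesis gamma_sum : (\esum_(u in [set: {fset nat}])
  ((gamma u)%:E * diag_moment rho k ^+ #|` u|) < +oo)%E.
Variable HK : rkhs (frakX k gamma) (kernel_inf k gamma).
Variable HKv : forall v, rkhs [set: sequences T] (kernel_fin k gamma v).

Let X := frakX k gamma.
Let I := integral_on X mu.
Let F := unit_ball HK.

Lemma integral_on_sub_scale (b : R) f h : rkhs_fun HK f -> rkhs_fun HK h ->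
  I (fun x => b * (f x - h x)) = b * (I f - I h).
Proof.
move=> Hf Hh.
have integrable g : rkhs_fun HK g -> mu.-integrable X (EFin \o g).
  move=> Hg; exact (rkhs_frakX_integrable mu_prod k_pos k_meas gamma_ge0 k_moment
    gamma_sum Hg).
have mX := measurable_frakX k_pos k_meas gamma_ge0.
rewrite /I /integral_on RintegralZl//; last exact: integrable (rkhs_fun_sub Hf Hh).
by rewrite RintegralB//; exact: integrable.
Qed.

(** * Lower bound from the bias *)

Section BiasBound.
Variables (v : {fset nat}) (a : sequences T) (Q : rand_alg (R := R) (sequences T)).
Hypothesis QF : algorithm_for F Q.
Hypothesis escape_le : forall f, F f ->
  (alg_prob Q (escape (anchored_set v a) f) <= (2^-1)%:E)%E.

(** The fooling pair is plus and minus [(f - h) / (1 + r)], where [h] is [Psi v a f] cut off to [X];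
    the inclusion of [H(K_v)] in [H(K)] bounds the norm of [h] by [r]. *)
Lemma mean_square_error_ge_bias f (r : R) : F f -> 0 <= r ->
  (rkhs_norm (HKv v) (Psi v a f) <= r%:E)%E ->
  (((`|I f - I (Psi v a f)| / (1 + r)) ^+ 2 / 2)%:E <= mean_square_error I Q F)%E.
Proof.
move=> Ff r0; rewrite /rkhs_norm; case: asboolP => // HPsi; rewrite lee_fin => Psir.
have [Hf f1] := (unit_ballP HK f).1 Ff.
pose h := patch (fun=> 0) X (Psi v a f).
have [Hh hPsi] : rkhs_fun HK h /\ dotp HK h h <= dotp (HKv v) (Psi v a f) (Psi v a f).
  exact: rkhs_frakX_inclusion.
have hr : dotp HK h h <= r ^+ 2.
  apply: (le_trans hPsi); rewrite -[leLHS]sqr_sqrtr ?dotp_ge0//.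
  by rewrite ler_sqr ?nnegrE ?sqrtr_ge0.
have r1 : 0 < 1 + r by rewrite ltr_pwDl.
(* Triangle inequality in squared form: the mixed product [C] satisfies [C^2 <= r^2], hence
   [- C <= r]. *)
have fh : dotp HK (f \- h) (f \- h) <= (1 + r) ^+ 2.
  rewrite dotp_sub//; have := dotp_cs Hf Hh.
  have := dotp_ge0 Hf; have := dotp_ge0 Hh.
  move: (dotp HK f f) (dotp HK h h) (dotp HK f h) f1 hr => A B C A1 Br B0 A0 CAB.
  have : C ^+ 2 <= r ^+ 2 by nra.
  have [NCr|rNC] := leP (- C) r; first by nra.
  by move=> Cr; exfalso; nra.
(* The values of [b] used are [1 / (1 + r)] and its negative. *)
pose g b x := b * (f x - h x).
have Fg b : b ^+ 2 = (1 + r) ^- 2 -> F (g b).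
  move=> bE; apply/unit_ballP.
  have -> : g b = fun x => b * (f \- h) x + 0 by apply: funext => x; rewrite addr0.
  have Hs := rkhs_fun_sub Hf Hh; split; first exact: rkhsP (rkhs0 HK).
  rewrite dotp_axpy//; last exact: rkhs0.
  have H0 := rkhs0 HK.
  rewrite (dotpC Hs H0) !dotp0l//.
  by rewrite mulr0 !addr0 bE mulrC ler_pdivrMr ?exprn_gt0// mul1r.
have g0 b x : anchored_set v a x -> g b x = 0.
  move=> xa; rewrite /g; have [Xx|Xx] := pselect (X x); last first.
    by rewrite /h patchE memNset// (rkhs_out Hf Xx) subrr mulr0.
  rewrite /h patchE mem_set//.
  have -> : Psi v a f x = f x.
    rewrite /Psi; congr f; apply: funext => j; rewrite /Defs.glue.
    by case: (boolP (j \in v)) => // jv; rewrite xa.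
  by rewrite subrr mulr0.
have Ig b : I (g b) = b * (I f - I (Psi v a f)).
  rewrite /g integral_on_sub_scale//; congr (_ * (_ - _)).
  by apply: eq_Rintegral => x xX; rewrite /h patchE xX.
have inv2 : ((1 + r)^-1) ^+ 2 = (1 + r) ^- 2 by rewrite exprVn.
have inv2N : (- (1 + r)^-1) ^+ 2 = (1 + r) ^- 2 by rewrite sqrrN.
have := mean_square_error_ge_escape (I := I) QF (measurable_anchored_set v a
  measurable_point) (Fg _ inv2) (Fg _ inv2N) _ (g0 _) (g0 _) (escape_le (Fg _ inv2)).
rewrite !Ig mulNr => /(_ erefl); congr (_%:E <= _)%E.
by rewrite !exprMn real_normK ?num_real//; congr (_ / _); exact: mulrC.
Qed.

Lemma mean_square_error_ge_bias_ratio (B : R) : 0 < B ->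
  (B%:E <= bias I F v a / (1 + operator_norm HK (HKv v) (Psi v a)))%E ->
  ((B ^+ 2 / 2)%:E <= mean_square_error I Q F)%E.
Proof.
move=> B0; set op := operator_norm _ _ _ => Ble.
have F0 : F (fun=> 0) by exact: unit_ball0.
have le_op f : F f -> (rkhs_norm (HKv v) (Psi v a f) <= op)%E.
  by move=> Ff; apply: ereal_sup_ubound; exists f.
have op0 : (0 <= op)%E.
  apply: le_trans (le_op _ F0); rewrite /rkhs_norm.
  by case: asboolP => // _; rewrite lee_fin sqrtr_ge0.
(* For an infinite operator norm the quotient is 0, against [0 < B]. *)
case: op op0 le_op Ble => [r| |//] op0 le_op Ble; last first.
  by move: Ble; rewrite addey// invey mule0 lee_fin leNgt B0.
rewrite lee_fin in op0; have r1 : 0 < 1 + r by rewrite ltr_pwDl.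
move: Ble; rewrite -EFinD inver gt_eqF// => Ble.
rewrite leNgt; apply/negP => mlt; move: Ble; apply/negP; rewrite -ltNge.
have m0 := mean_square_error_ge0 I Q F0.
have : exists2 m, 0 <= m & mean_square_error I Q F = m%:E.
  case: mean_square_error m0 mlt => [m m0 _|//|//]; by exists m.
move=> [m m_ge0 mE]; move: mlt; rewrite mE lte_fin => mlt.
(* If [m < B^2 / 2], the bound for each [f] caps the bias at [(1 + r) sqrt (2 m)], which is below
   [(1 + r) B]. *)
have bias_le : (bias I F v a <= ((1 + r) * Num.sqrt (2 * m))%:E)%E.
  apply: ge_ereal_sup => _ [f Ff <-]; rewrite lee_fin mulrC -ler_pdivrMr//.
  have := mean_square_error_ge_bias Ff op0 (le_op f Ff).
  rewrite mE lee_fin => h.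
  rewrite -[leLHS]ger0_norm ?divr_ge0 ?(ltW r1)// -sqrtr_sqr ler_wsqrtr//.
  by move: h; lra.
rewrite lte_pdivrMr//; apply: (le_lt_trans bias_le).
rewrite -EFinM lte_fin mulrC ltr_pM2r// -[ltRHS]gtr0_norm// -sqrtr_sqr.
by rewrite ltr_sqrt ?exprn_gt0//; lra.
Qed.

End BiasBound.

Lemma escape_prob_le_half (c : sequences T -> \bar R) (S : set (sequences T))
    (Q : rand_alg (R := R) (sequences T)) f (N : R) :
  algorithm_for F Q -> measurable S -> F f -> 0 < N ->
  (forall x, (0 <= c x)%E) -> (forall x, ~ S x -> ((4 * N)%:E <= c x)%E) ->
  (expected_cost c Q f <= (2 * N)%:E)%E ->
  (alg_prob Q (escape S f) <= (2^-1)%:E)%E.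
Proof.
move=> QF mS Ff N0 c0 cS cN.
have N4 : 0 <= 4 * N by rewrite mulr_ge0 ?(ltW N0).
have := escape_prob_le QF mS Ff N4 c0 cS cN.
case: (alg_prob Q _) => [r| |]; last by rewrite leNye.
  by rewrite -EFinM !lee_fin => h; rewrite -(ler_pM2l N0); lra.
by rewrite gt0_muley ?lte_fin ?mulr_gt0.
Qed.

(** * Lower bound from the univariate problem *)

Section UnivariateBound.
Variables (v : {fset nat}) (C alpha : R).
Hypothesis univ_le : forall n, (0 < n)%N ->
  ((C * n%:R `^ (- alpha))%:E <= min_error_evals I (unit_ball (HKv v)) n ^+ 2)%E.

(** Run on restrictions to [X], [Q] becomes a univariate algorithm with at most [B / t] expected
    evaluations. Its inputs stay in the unit ball and keep their integrals, so its error does not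
    exceed that of [Q]. *)
Lemma error_ge_univariate (Q : rand_alg (R := R) (sequences T))
    (c : sequences T -> \bar R) (t B : R) n :
  algorithm_for F Q -> 0 < t -> (forall x, (t%:E <= c x)%E) ->
  (forall f, F f -> (expected_cost c Q f <= B%:E)%E) ->
  (0 < n)%N -> B / t <= n%:R ->
  ((Num.sqrt (C * n%:R `^ (- alpha)))%:E <= error I Q F)%E.
Proof.
move=> QF t0 ct cB n0 Bn.
have patchF f : unit_ball (HKv v) f -> F (patch (fun=> 0) X f).
  move=> /unit_ballP[Hf f1]; apply/unit_ballP.
  have [Hpf pf] := rkhs_frakX_inclusion k_pos gamma_ge0 HK Hf.
  by split=> //; exact: le_trans pf f1.
have Fv0 : unit_ball (HKv v) (fun=> 0) by exact: unit_ball0.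
apply: (@le_trans _ _ (error I (restrict_alg X Q) (unit_ball (HKv v)))); last first.
  apply: (error_restrict_alg_le _ Fv0) => // f _.
  by apply: eq_Rintegral => x xX; rewrite patchE xX.
apply: (@le_trans _ _ (min_error_evals I (unit_ball (HKv v)) n)).
  apply: sqrt_le_expe2; last exact: univ_le.
  by apply: le_ereal_inf_tmp => _ [Q' [_ _ ->]]; exact: poweR_ge0.
apply: ereal_inf_lbound; exists (restrict_alg X Q); split=> //.
  exact: restrict_alg_for patchF QF.
move=> f /patchF Ff; rewrite /expected_evals expected_cost_restrict_alg.
apply: le_trans (expected_evals_le QF Ff t0 ct (cB _ Ff)) _.
by rewrite lee_fin.
Qed.

End UnivariateBound.

(** The cost is an infimum over [C] that need not be attained; doubling the budget, a strict
    increase for [N > 0], yields an actual cost function [c]. *)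
Lemma min_error_sq_ge C (N : nat) (a : R) : 0 <= a ->
  (forall c Q, C c -> algorithm_for F Q ->
    (forall f, F f -> (expected_cost c Q f <= (2 * N%:R)%:E)%E) ->
    ((Num.sqrt a)%:E <= error I Q F)%E) ->
  (0 < N)%N -> (a%:E <= min_error I C F N ^+ 2)%E.
Proof.
move=> a0 h N0; apply: le_expe2_sqrt => //; apply: le_ereal_inf_tmp => _ [Q [QF QN ->]].
have : (cost C Q F < (2 * N%:R)%:E)%E.
  apply: le_lt_trans QN _; rewrite lte_fin ltr_pMl ?ltr0n//.
  by rewrite ltr1n.
move=> /ereal_inf_lt[_ [c Cc <-] cN]; apply: (h c) => // f Ff.
by apply: le_trans (ltW cN); apply: ereal_sup_ubound; exists f.
Qed.

(** * Rates for fixed and variable subspace sampling *)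

Section Rates.
Variables (adm : set (sequences T)) (doll : nat -> R).
Variables (s alpha beta cd cb cu : R) (v0 : {fset nat}).
Hypothesis doll_ge0 : forall n, 0 <= doll n.
Hypothesis doll_mono : forall m n, (m <= n)%N -> doll m <= doll n.
Hypotheses (s_gt0 : 0 < s) (alpha_gt0 : 0 < alpha) (beta_gt0 : 0 < beta).
Hypotheses (cd_gt0 : 0 < cd) (cb_gt0 : 0 < cb) (cu_gt0 : 0 < cu).
Hypothesis doll_ge : forall n, (0 < n)%N -> cd * n%:R `^ s <= doll n.
Hypothesis bias_ge : forall v a, v != fset0 -> adm a ->
  ((cb * #|` v|%:R `^ (- (beta / 2)))%:E <=
   bias I F v a / (1 + operator_norm HK (HKv v) (Psi v a)))%E.
Hypothesis univ_ge : forall n, (0 < n)%N ->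
  ((cu * n%:R `^ (- alpha))%:E <= min_error_evals I (unit_ball (HKv v0)) n ^+ 2)%E.

Variables (Q : rand_alg (R := R) (sequences T)) (c : sequences T -> \bar R) (N : R).
Hypothesis QF : algorithm_for F Q.
Hypothesis N_ge1 : 1 <= N.
Hypothesis cN : forall f, F f -> (expected_cost c Q f <= (2 * N)%:E)%E.

Let N_gt0 : 0 < N := lt_le_trans ltr01 N_ge1.

Lemma error_ge_bias v a : v != fset0 -> adm a -> (forall x, (0 <= c x)%E) ->
  (forall x, ~ anchored_set v a x -> ((4 * N)%:E <= c x)%E) ->
  ((Num.sqrt (cb ^+ 2 / 2 * #|` v|%:R `^ (- beta)))%:E <= error I Q F)%E.
Proof.
move=> v_neq0 adma c0 cS.
have v_gt0 : 0 < #|` v|%:R :> R by rewrite ltr0n cardfs_gt0.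
apply: sqrt_le_error; first by rewrite mulr_ge0 ?powR_ge0// divr_ge0 ?sqr_ge0.
have := mean_square_error_ge_bias_ratio QF _ _ (bias_ge v_neq0 adma).
rewrite exprMn -(powR_mulrn 2 (powR_ge0 _ _)) -powRrM.
rewrite (_ : - (beta / 2) * 2 = - beta); last by field.
rewrite mulrAC; apply; last by rewrite mulr_gt0 ?powR_gt0.
move=> f Ff; apply: (escape_prob_le_half QF _ Ff N_gt0 c0 cS (cN Ff)).
exact: measurable_anchored_set.
Qed.

Lemma error_ge_evals (t y : R) : 0 < t -> (forall x, (t%:E <= c x)%E) ->
  0 < y -> 2 * N / t + 1 <= y ->
  ((Num.sqrt (cu * y `^ (- alpha)))%:E <= error I Q F)%E.
Proof.
move=> t0 ct y0 yle.
have Nt : 0 <= 2 * N / t by rewrite divr_ge0 ?mulr_ge0 ?(ltW N_gt0) ?(ltW t0).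
(* The univariate bound is available at integers only; [n] exceeds [2 N / t] by at most 1. *)
pose n := (Num.trunc (2 * N / t)).+1.
have /andP[nle nge] := trunc_itv Nt.
apply: le_trans (error_ge_univariate univ_ge QF t0 ct cN (ltn0Sn _) (ltW nge)).
rewrite lee_fin ler_wsqrtr// ler_pM2l// ler_powRN ?ltr0n ?(ltW alpha_gt0)//.
by rewrite -natr1 (le_trans _ yle)// lerD2r.
Qed.

(** The threshold [N^delta] for [|v|] balances the two bounds: small [v] gives the exponent
    [delta beta], while large [v] leaves of order [N^eta] evaluations and gives [eta alpha]; both
    products equal [theta]. *)
Lemma error_ge_fix v a : adm a -> c = cost_fix doll v a ->
  ((Num.sqrt (Num.min (cb ^+ 2 / 2) (cu * (2 / cd + 1) `^ (- alpha)) *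
      N `^ (- (alpha * beta / (alpha * s + beta)))))%:E <= error I Q F)%E.
Proof.
move=> adma cE; set theta := alpha * beta / _.
have asb : 0 < alpha * s + beta by rewrite addr_gt0 ?mulr_gt0.
pose delta := alpha / (alpha * s + beta).
have delta0 : 0 < delta by rewrite divr_gt0.
have cb2 : 0 <= cb ^+ 2 / 2 by rewrite divr_ge0 ?sqr_ge0.
have K0 : 0 < 2 / cd + 1 by rewrite addr_gt0 ?divr_gt0.
set C := Num.min _ _.
have C1 : C <= cb ^+ 2 / 2 by rewrite ge_min lexx.
have C2 : C <= cu * (2 / cd + 1) `^ (- alpha) by rewrite ge_min lexx orbT.
(* Points off [anchored_set v' a] are off [anchored_set v a] as well and have infinite cost. The
   freedom in [v'] serves the case of empty [v]. *)
have few (v' : {fset nat}) : v' != fset0 -> (v `<=` v')%fset ->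
    #|` v'|%:R <= N `^ delta ->
    ((Num.sqrt (C * N `^ (- theta)))%:E <= error I Q F)%E.
  move=> v'0 vv' v'N; apply: le_trans (error_ge_bias v'0 adma _ _).
  - rewrite lee_fin ler_wsqrtr// ler_pM ?powR_ge0//.
      by rewrite le_min cb2 mulr_ge0 ?powR_ge0// ltW.
    rewrite (_ : - theta = delta * - beta); last first.
      by rewrite /theta /delta; field; rewrite gt_eqF.
    by rewrite powRrM ler_powRN ?(ltW beta_gt0)// ltr0n cardfs_gt0.
  - by move=> x; rewrite cE /cost_fix; case: asboolP; rewrite ?lee_fin ?leey.
  - move=> x Sx; rewrite cE /cost_fix asboolF ?leey// => xa; apply: Sx => j jv'.
    by apply: xa; apply: contraNN jv'; apply: (fsubsetP vv').
have N1 : 1 <= N `^ delta by rewrite -(powRr0 N) ler_powR// ltW.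
(* The bias hypothesis concerns non-empty sets, so an empty [v] is enlarged to a singleton. *)
have [v_eq0|v_neq0] := eqVneq v fset0.
  apply: (few [fset 0%N]%fset); rewrite ?v_eq0 ?fsub0set//.
    by rewrite -cardfs_gt0 cardfs1.
  by rewrite cardfs1.
have [|vN] := leP #|` v|%:R (N `^ delta); first by apply: few.
have v_gt0 : (0 < #|` v|)%N by rewrite cardfs_gt0.
have dv : cd * N `^ (delta * s) <= doll #|` v|.
  apply: le_trans (doll_ge v_gt0); rewrite ler_pM2l// powRrM.
  by apply: ge0_ler_powR; rewrite ?nnegrE ?powR_ge0// ltW.
have t0 : 0 < cd * N `^ (delta * s) by rewrite mulr_gt0 ?powR_gt0.
pose eta := beta / (alpha * s + beta).
have eta0 : 0 < eta by rewrite divr_gt0.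
(* The exponents satisfy [1 - delta s = eta]. *)
have Neta : N / N `^ (delta * s) = N `^ eta.
  rewrite -{1}(powRr1 (ltW N_gt0)) -powRN -powRD; last by rewrite (gt_eqF N_gt0) implybT.
  by congr (_ `^ _); rewrite /delta /eta; field; rewrite gt_eqF.
have Neta1 : 1 <= N `^ eta by rewrite -(powRr0 N) ler_powR// ltW.
(* Here [2 N / t = (2 / cd) N^eta], and the additional 1 is absorbed by [N^eta >= 1]. *)
apply: le_trans (error_ge_evals (y := (2 / cd + 1) * N `^ eta) t0 _ _ _).
- rewrite lee_fin ler_wsqrtr// powRM ?powR_ge0 ?(ltW K0)// mulrA -powRrM.
  rewrite (_ : - theta = eta * - alpha); last first.
    by rewrite /theta /eta; field; rewrite gt_eqF.
  by rewrite ler_wpM2r ?powR_ge0.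
- by move=> x; rewrite cE /cost_fix; case: asboolP => _; rewrite ?leey ?lee_fin.
- by rewrite mulr_gt0 ?powR_gt0.
- by rewrite invfM mulrACA Neta [leRHS]mulrDl mul1r lerD2l.
Qed.

Lemma cardfs_increasing (vs : nat -> {fset nat}) :
  (forall i, vs i != fset0) -> (forall i, (vs i `<` vs i.+1)%fset) ->
  forall i, (i < #|` vs i|)%N.
Proof.
move=> vs0 vsS; elim=> [|i IH]; first by rewrite cardfs_gt0.
exact: leq_ltn_trans IH (fproper_ltn_card (vsS i)).
Qed.

Lemma error_ge_var vs a : (forall i, vs i != fset0) ->
  (forall i, (vs i `<` vs i.+1)%fset) -> adm a -> c = cost_var doll vs a ->
  ((Num.sqrt (Num.min (cb ^+ 2 / 2 * (4 / cd + 1) `^ (- (beta / s)))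
      (cu * (2 / cd + 1) `^ (- alpha)) *
      N `^ (- Num.min alpha (beta / s))))%:E <= error I Q F)%E.
Proof.
move=> vs0 vsS adma cE.
have bs0 : 0 < beta / s by rewrite divr_gt0.
have card_vs := cardfs_increasing vs0 vsS.
have vs_mono i j : (i <= j)%N -> (vs i `<=` vs j)%fset.
  move=> /subnK <-; elim: (j - i)%N => // m IH; rewrite addSn.
  by apply: fsubset_trans IH _; exact: fproper_sub.
(* A point in none of the subspaces is covered too: its infimum is infinite. *)
have c_ge (x : sequences T) (t : R) :
    (forall i, anchored_set (vs i) a x -> t <= doll #|` vs i|) -> (t%:E <= c x)%E.
  move=> h; rewrite cE; apply: le_ereal_inf_tmp => _ [i xi <-].
  by rewrite lee_fin h.
set C := Num.min _ _.
have C1 : C <= cb ^+ 2 / 2 * (4 / cd + 1) `^ (- (beta / s)).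
  by rewrite ge_min lexx.
have C2 : C <= cu * (2 / cd + 1) `^ (- alpha) by rewrite ge_min lexx orbT.
(* If [alpha] is the smaller exponent, the univariate bound applies: each [vs i] is non-empty, so
   every evaluation costs at least [doll 1 >= cd]. *)
have [ab|ba] := leP alpha (beta / s).
  have K0 : 0 < 2 / cd + 1 by rewrite addr_gt0 ?divr_gt0.
  apply: le_trans (error_ge_evals (y := (2 / cd + 1) * N) cd_gt0 _ _ _).
  - rewrite lee_fin ler_wsqrtr// powRM ?(ltW N_gt0) ?(ltW K0)// mulrA.
    by rewrite ler_wpM2r ?powR_ge0.
  - move=> x; apply: c_ge => i _; have i0 : (0 < #|` vs i|)%N.
      by rewrite cardfs_gt0.
    apply: le_trans (doll_mono i0).
    by apply: le_trans (doll_ge (ltn0Sn 0)); rewrite powR1 mulr1.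
  - by rewrite mulr_gt0.
  - by rewrite [2 * N / cd]mulrAC [leRHS]mulrDl mul1r lerD2l.
have K0 : 0 < 4 / cd + 1 by rewrite addr_gt0 ?divr_gt0.
(* In the constant, [4 / cd] comes from [doll |v| < 4 N], and the summand 1 covers a singleton
   [v]. *)
have few (v : {fset nat}) : v != fset0 -> #|` v|%:R `^ s <= (4 / cd + 1) * N ->
    (forall x, ~ anchored_set v a x -> ((4 * N)%:E <= c x)%E) ->
    ((Num.sqrt (C * N `^ (- (beta / s))))%:E <= error I Q F)%E.
  move=> v_neq0 vN cS; apply: le_trans (error_ge_bias v_neq0 adma _ cS); last first.
    by move=> x; apply: c_ge.
  have v_gt0 : 0 < #|` v|%:R :> R by rewrite ltr0n cardfs_gt0.
  rewrite lee_fin ler_wsqrtr//.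
  rewrite (_ : - beta = s * - (beta / s)); last by field; rewrite gt_eqF.
  rewrite powRrM.
  apply: (@le_trans _ _ (cb ^+ 2 / 2 * ((4 / cd + 1) * N) `^ (- (beta / s)))).
    rewrite powRM ?(ltW N_gt0) ?(ltW K0)// mulrA.
    by rewrite ler_wpM2r ?powR_ge0.
  rewrite ler_wpM2l ?divr_ge0 ?sqr_ge0// ler_powRN ?powR_gt0//.
  exact: ltW.
(* Since [|vs i| > i], an [i] beyond [(4 N / cd)^(1/s)] works. *)
have ex_large : exists i, 4 * N <= doll #|` vs i|.
  pose i := Num.bound ((4 * N / cd) `^ s^-1).
  exists i; apply: le_trans (doll_mono (ltnW (card_vs i))).
  have := archi_boundP (powR_ge0 (4 * N / cd) s^-1); rewrite -/i => i_gt.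
  have i0 : (0 < i)%N.
    by rewrite -(@ltr0n R); apply: le_lt_trans i_gt; exact: powR_ge0.
  apply: le_trans (doll_ge i0); rewrite -ler_pdivrMl// mulrC.
  have N4 : 0 <= 4 * N / cd by rewrite divr_ge0 ?mulr_ge0 ?(ltW N_gt0) ?(ltW cd_gt0).
  have -> : 4 * N / cd = ((4 * N / cd) `^ s^-1) `^ s.
    by rewrite -powRrM mulVf ?gt_eqF// powRr1.
  by apply: ge0_ler_powR; rewrite ?nnegrE ?powR_ge0 ?(ltW s_gt0)// ltW.
(* The first index of cost at least [4 N]. If it is 0, every evaluation costs that much and a
   singleton serves; if it is [j.+1], the set [vs j] is taken. *)
have [[|j] jP jmin] := ex_minnP ex_large.
  apply: (few [fset 0%N]%fset).
  - by rewrite -cardfs_gt0 cardfs1.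
  - by rewrite cardfs1 powR1; rewrite mulr_ege1// lerDr divr_ge0// ltW.
  - move=> x _; apply: c_ge => i _; apply: le_trans jP _.
    by apply: doll_mono; apply: fsubset_leq_card; exact: vs_mono.
have vj : doll #|` vs j| < 4 * N.
  by rewrite ltNge; apply/negP => /jmin; rewrite ltnn.
apply: (few (vs j)) => //.
  have vj_gt0 : (0 < #|` vs j|)%N by rewrite cardfs_gt0.
  have h := le_lt_trans (doll_ge vj_gt0) vj.
  rewrite -(ler_pM2l cd_gt0) mulrA mulrDr mulr1 mulrCA divff ?gt_eqF// mulr1.
  by apply: (le_trans (ltW h)); rewrite mulrDl lerDl mulr_ge0 ?(ltW cd_gt0) ?(ltW N_gt0).
(* The subspaces increase with the index, so a point off the one of [vs j] lies only in those of
   index above [j]. *)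
move=> x Sx; apply: c_ge => i xi; apply: le_trans jP _; apply: doll_mono.
have ji : (j < i)%N.
  rewrite ltnNge; apply/negP => ij; apply: Sx => l lj.
  by apply: xi; apply: contraNN lj; apply: (fsubsetP (vs_mono _ _ ij)).
by apply: fsubset_leq_card; exact: vs_mono.
Qed.

End Rates.

End LowerBounds.

(** A point of [D] is the trace of a Borel singleton; this makes the anchored sets measurable. *)
Lemma measurable_point_borel_subset (R : realType) (D : set R) (d0 : D)
  (y : borel_subset d0) : measurable [set y].
Proof.
exists [set set_val y]; first exact: measurable_set1.
rewrite setTI; apply/seteqP; split=> [z /= /val_inj //|z /= -> //].
Qed.

Theorem theorem3p2 (R : realType) (D : set R) (d0 : D)
  (rho : probability (borel_subset d0) R)
  (mu : probability (sequences (borel_subset d0)) R)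
  (mu_prod : is_product_measure rho mu)
  (k : borel_subset d0 -> borel_subset d0 -> R)
  (gamma : {fset nat} -> R)
  (Hk : rkhs [set: borel_subset d0] k)
  (H1 : rkhs [set: borel_subset d0] (fun _ _ => 1))
  (HK : rkhs (frakX k gamma) (kernel_inf k gamma))
  (HKv : forall v, rkhs [set: sequences (borel_subset d0)]
                        (kernel_fin k gamma v))
  (k_kernel : reproducing_kernel k)
  (k_neq0 : k <> (fun _ _ => 0))
  (k_meas : measurable_fun [set: borel_subset d0 * borel_subset d0]
              (fun z => k z.1 z.2))
  (k_const : rkhs_fun Hk `&` rkhs_fun H1 = [set (fun=> 0)])
  (k_moment : (diag_moment rho k < +oo)%E)
  (k_centered : forall y, (\int[rho]_x (k x y)%:E = 0)%E)
  (k_pos : forall a, 0 < k a a)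
  (gamma_ge0 : forall u, 0 <= gamma u)
  (gamma0 : gamma fset0 = 1)
  (gamma_sum : (\esum_(u in [set: {fset nat}])
                  ((gamma u)%:E * diag_moment rho k ^+ #|` u|) < +oo)%E)
  (adm : set (sequences (borel_subset d0)))
  (adm_sub : adm `<=` frakX k gamma)
  (doll : nat -> R)
  (doll_ge0 : forall n, 0 <= doll n)
  (doll_mono : forall m n, (m <= n)%N -> doll m <= doll n)
  (s p sigma alpha : R)
  (s_gt0 : 0 < s)
  (doll_Omega : is_Omega [set n | (0 < n)%N]
                  (fun n => (doll n)%:E) (fun n => n%:R `^ s))
  (p_gt1 : 1 < p)
  (sigma_gt0 : 0 < sigma)
  (bias_Omega :
     is_Omega [set va : {fset nat} * sequences (borel_subset d0) |
                va.1 != fset0 /\ adm va.2]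
       (fun va =>
          (bias (integral_on (frakX k gamma) mu) (unit_ball HK) va.1 va.2
           / (1 + operator_norm HK (HKv va.1) (Psi va.1 va.2)))%E)
       (fun va => #|` va.1|%:R `^ (sigma * (1 - p) / 2)))
  (gamma1_gt0 : 0 < gamma [fset 0%N]%fset)
  (alpha_gt0 : 0 < alpha)
  (univ_Omega :
     is_Omega [set N | (0 < N)%N]
       (fun N => (min_error_evals (integral_on (frakX k gamma) mu)
                    (unit_ball (HKv [fset 0%N]%fset)) N ^+ 2)%E)
       (fun N => N%:R `^ (- alpha))) :
  is_Omega [set N | (0 < N)%N]
    (fun N => (min_error (integral_on (frakX k gamma) mu) (C_fix doll adm)
                 (unit_ball HK) N ^+ 2)%E)
    (fun N => N%:R `^ (- (alpha * sigma * (p - 1)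
                          / (alpha * s + sigma * (p - 1)))))
  /\
  is_Omega [set N | (0 < N)%N]
    (fun N => (min_error (integral_on (frakX k gamma) mu) (C_var doll adm)
                 (unit_ball HK) N ^+ 2)%E)
    (fun N => N%:R `^ (- Num.min alpha (sigma * (p - 1) / s))).
Proof.
have k_pos' := reproducing_kernel_positive k_kernel.
have m1 := @measurable_point_borel_subset R D d0.
pose beta := sigma * (p - 1).
have beta_gt0 : 0 < beta by rewrite mulr_gt0// subr_gt0.
have [cd cd_gt0 doll_ge] := doll_Omega.
have [cb cb_gt0 bias_ge'] := bias_Omega.
have [cu cu_gt0 univ_ge] := univ_Omega.
have bias_ge v a : v != fset0 -> adm a ->
    ((cb * #|` v|%:R `^ (- (beta / 2)))%:E <=
     bias (integral_on (frakX k gamma) mu) (unit_ball HK) v a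
     / (1 + operator_norm HK (HKv v) (Psi v a)))%E.
  move=> v0 adma; have := bias_ge' (v, a) (conj v0 adma).
  by rewrite /= (_ : sigma * (1 - p) / 2 = - (beta / 2))// /beta; field.
have cd1 c0 : 0 < c0 -> 0 < c0 / cd + 1 by move=> ?; rewrite addr_gt0 ?divr_gt0.
split.
  rewrite (_ : alpha * sigma * (p - 1) / (alpha * s + sigma * (p - 1)) =
    alpha * beta / (alpha * s + beta)); last by rewrite /beta mulrA.
  have C_gt0 : 0 < Num.min (cb ^+ 2 / 2) (cu * (2 / cd + 1) `^ (- alpha)).
    by rewrite lt_min divr_gt0 ?exprn_gt0// mulr_gt0 ?powR_gt0 ?cd1.
  exists (Num.min (cb ^+ 2 / 2) (cu * (2 / cd + 1) `^ (- alpha))) => //.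
  move=> N N0; apply: min_error_sq_ge => //.
    by rewrite mulr_ge0 ?powR_ge0// ltW.
  move=> c Q [v [a adma ->]] QF cN.
  apply: (error_ge_fix mu_prod m1 k_pos' k_meas gamma_ge0 k_moment gamma_sum
    doll_ge0 s_gt0 alpha_gt0 beta_gt0 cd_gt0 cb_gt0 cu_gt0 doll_ge bias_ge
    univ_ge QF _ cN adma) => //.
  by rewrite ler1n.
have C_gt0 : 0 < Num.min (cb ^+ 2 / 2 * (4 / cd + 1) `^ (- (beta / s)))
    (cu * (2 / cd + 1) `^ (- alpha)).
  by rewrite lt_min !mulr_gt0 ?powR_gt0 ?cd1 ?invr_gt0.
exists (Num.min (cb ^+ 2 / 2 * (4 / cd + 1) `^ (- (beta / s)))
    (cu * (2 / cd + 1) `^ (- alpha))) => //.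
move=> N N0; apply: min_error_sq_ge => //.
  by rewrite mulr_ge0 ?powR_ge0// ltW.
move=> c Q [vs [vs0 vsS [a adma ->]]] QF cN.
apply: (error_ge_var mu_prod m1 k_pos' k_meas gamma_ge0 k_moment gamma_sum
    doll_ge0 doll_mono s_gt0 alpha_gt0 beta_gt0 cd_gt0 cb_gt0 cu_gt0 doll_ge
    bias_ge univ_ge QF _ cN vs0 vsS adma) => //.
by rewrite ler1n.
Qed.
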